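(* Let $\mu$ be a self-dual, translation-invariant, ergodic edge percolation measure on $\mathbb{Z}^2$ that almost surely has only finitely many infinite clusters. Then $\mu_{\mathrm{hp}}$ almost surely has no infinite cluster. In particular, if $\mu$ is a self-dual, translation-invariant, ergodic, finite-energy edge percolation measure on $\mathbb{Z}^2$, then $\mu_{\mathrm{hp}}$ almost surely has no infinite cluster.
   Context: Here $\mathbb{Z}^2$ denotes the square lattice graph: the Cayley graph of the group $\mathbb{Z}^2$ with generators $(1,0),(0,1)$, with edge set $E(\mathbb{Z}^2)$. A (spanning) subgraph corresponds to $\omega\in\{0,1\}^{E(\mathbb{Z}^2)}$, where $\omega_e=1$ means $e$ is open (present) and $\omega_e=0$ means $e$ is closed (absent). An edge percolation measure on $\mathbb{Z}^2$ is a probability measure on $\{0,1\}^{E(\mathbb{Z}^2)}$ (product topology, Borel $\sigma$-algebra). A cluster is a connected component of the subgraph of open edges; it is infinite if it has infinitely many vertices. Statements such as ''almost surely $\mu$ has $k$ infinite clusters'' refer to a random subgraph sampled from $\mu$. The group $\mathbb{Z}^2$ acts on $\{0,1\}^{E(\mathbb{Z}^2)}$ by translations. The measure $\mu$ is translation-invariant if it is invariant under this action, and ergodic if it is ergodic with respect to this action. The measure $\mu$ has finite-energy if there is some $\delta>0$ such that for every $e\in E(\mathbb{Z}^2)$, the conditional probability $\mu(\omega_e=1\mid\omega_{E(\mathbb{Z}^2)\setminus\{e\}})$ has essential infimum at least $\delta$ and essential supremum at most $1-\delta$. Duality: the planar dual $(\mathbb{Z}^2)^*$ has the plaquettes (unit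 square faces) of $\mathbb{Z}^2$ as vertices, and each edge $e$ of $\mathbb{Z}^2$ corresponds to a dual edge $e^*$ joining the two plaquettes touching $e$. The dual is identified with $\mathbb{Z}^2$ by identifying the vertex $(x,y)$ with the plaquette centered at $(x+1/2,y+1/2)$. The dual $H^*$ of a subgraph $H$ has $e^*$ open if and only if $e$ is closed in $H$. The dual measure $\mu^*$ is the law of $H^*$ when $H$ is sampled from $\mu$, viewed as an edge percolation measure on $\mathbb{Z}^2$ via this identification. The measure $\mu$ is self-dual if $\mu^*=\mu$. $\mu_{\mathrm{hp}}$ denotes the marginal of $\mu$ on the upper half-plane $\mathbb{Z}\times\mathbb{Z}_{\ge 0}$ (i.e., the law of $\omega$ restricted to edges with both endpoints in $\mathbb{Z}\times\mathbb{Z}_{\geq 0}$). *)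

(* Defs.v *)
From HB Require Import structures.
From Stdlib Require Import Relation_Operators.
From mathcomp Require Import all_boot all_order all_algebra.
From mathcomp Require Import all_classical all_reals all_analysis.
From mathcomp Require Import ess_sup_inf.
From mathcomp Require Import zify.

Set Implicit Arguments.
Unset Strict Implicit.
Unset Printing Implicit Defensive.

Import Order.TTheory GRing.Theory Num.Theory.
Import numFieldNormedType.Exports.

Local Open Scope classical_set_scope.
Local Open Scope ring_scope.

Definition vertex : Type := (int * int)%type.

Definition generator (s : bool) : vertex := if s then (0, 1) else (1, 0).

(* [(v, s)] is the unoriented edge between [v] and [v + generator s]; every
   edge of the Cayley graph has exactly one such representation. *)
Definition edge : Type := (vertex * bool)%type.

Definition tail (e : edge) : vertex := e.1.
Definition head (e : edge) : vertex := e.1 + generator e.2.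

Definition joins (e : edge) (u v : vertex) : Prop :=
  (u = tail e /\ v = head e) \/ (u = head e /\ v = tail e).

(* Below, [V] is the vertex set of the ambient graph and [O] the set of open
   edges, which is meant to consist of edges with both endpoints in [V]. *)
Definition open_adj (O : set edge) (u v : vertex) : Prop :=
  exists2 e, O e & joins e u v.

Definition cluster_of (O : set edge) (v : vertex) : set vertex :=
  [set u | clos_refl_trans vertex (open_adj O) v u].

Definition clusters (V : set vertex) (O : set edge) : set (set vertex) :=
  [set cluster_of O v | v in V].

Definition infinite_clusters (V : set vertex) (O : set edge) :
  set (set vertex) := [set C | clusters V O C /\ infinite_set C].

Notation config I :=
  (g_sigma_algebraType (@open (prod_topology (fun _ : I => bool)))).

Lemma measurable_config (I J : Type) (f : config I -> config J) :
  (forall j, exists i (g : bool -> bool), forall w, f w j = g (w i)) ->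
  measurable_fun setT f.
Proof.
pose TI : topologicalType := prod_topology (fun _ : I => bool).
pose TJ : topologicalType := prod_topology (fun _ : J => bool).
move=> fE; apply: (@measurability _ _ (config I) (config J) _ _ (@open TJ)).
  by [].
move=> _ [A oA <-]; rewrite setTI; apply: sub_sigma_algebra; move: A oA.
suff : continuous (f : TI -> TJ) by move/continuousP.
move=> w; apply/cvg_sup => j.
apply: (@continuous_comp_initial _ TI _ (fun h : J -> bool => h j)).
have [i [g fg]] := fE j.
rewrite (_ : _ \o _ = g \o (fun u : TI => u i)); last exact/funext.
move=> u; apply: continuous_comp.
  have /cvg_sup/(_ i) ui : nbhs (u : TI) --> (u : TI) by exact: cvg_id.
  apply: cvg_trans (@initial_continuous _ _ (fun h : I -> bool => h i) u).
  exact: cvg_app.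
suff : continuous g by exact.
by apply/continuousP => A _; exact: discrete_open.
Qed.

Definition translate (v : vertex) (w : config edge) : config edge :=
  fun e => w (e.1 - v, e.2).

Definition open_edges (w : config edge) : set edge := [set e | w e].

Definition upper (v : vertex) : bool := 0 <= v.2.

Definition hp_edge : Type := {e : edge | upper (tail e) && upper (head e)}.

Definition hp_restrict (w : config edge) : config hp_edge :=
  fun e => w (val e).

Lemma measurable_hp_restrict : measurable_fun setT hp_restrict.
Proof. by apply: measurable_config => e; exists (val e), id. Qed.

HB.instance Definition _ :=
  isMeasurableFun.Build _ _ _ _ hp_restrict measurable_hp_restrict.

Definition hp_marginal (R : realType) (mu : probability (config edge) R) :
  probability (config hp_edge) R := distribution mu hp_restrict.

Definition hp_open_edges (w : config hp_edge) : set edge :=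
  [set val e | e in [set e : hp_edge | w e]].

(* A plaquette is named by its lower-left corner: the vertex [p] stands for the
   unit square centered at [p + (1/2, 1/2)]. *)
Definition corners (p : vertex) : seq vertex :=
  [:: p; p + (1, 0); p + (0, 1); p + (1, 1)].

Definition touches (e : edge) (p : vertex) : bool :=
  (tail e \in corners p) && (head e \in corners p).

Definition dual_edge (e : edge) : edge :=
  (e.1 - generator (~~ e.2), ~~ e.2).

Definition predual_edge (e : edge) : edge := (e.1 + generator e.2, ~~ e.2).

Lemma dual_edgeK : cancel dual_edge predual_edge.
Proof. by case=> v s; rewrite /predual_edge /dual_edge /= subrK negbK. Qed.

Lemma predual_edgeK : cancel predual_edge dual_edge.
Proof. by case=> v s; rewrite /predual_edge /dual_edge /= negbK addrK. Qed.

Lemma touches_dual_edge (e : edge) (p : vertex) :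
  touches e p = (p == tail (dual_edge e)) || (p == head (dual_edge e)).
Proof.
case: e => [[x y] []]; case: p => a b;
  rewrite /touches /corners /dual_edge /tail /head /= !inE;
  rewrite -!pair_eqE /pair_eq /= /generator /=; lia.
Qed.

Definition dual (w : config edge) : config edge :=
  fun e => ~~ w (predual_edge e).

Lemma dual_open (w : config edge) (e : edge) : dual w (dual_edge e) = ~~ w e.
Proof. by rewrite /dual dual_edgeK. Qed.

Lemma measurable_dual : measurable_fun setT dual.
Proof. by apply: measurable_config => e; exists (predual_edge e), negb. Qed.

HB.instance Definition _ :=
  isMeasurableFun.Build _ _ _ _ dual measurable_dual.

Definition dual_measure (R : realType) (mu : probability (config edge) R) :
  probability (config edge) R := distribution mu dual.

Section percolation_measures.
Context {R : realType}.
Implicit Type mu : probability (config edge) R.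

Definition self_dual mu : Prop :=
  forall A, measurable A -> dual_measure mu A = mu A.

Definition translation_invariant mu : Prop :=
  forall v A, measurable A -> mu (translate v @^-1` A) = mu A.

Definition ergodic mu : Prop :=
  forall A, measurable A -> (forall v, translate v @^-1` A = A) ->
    mu A = 0%E \/ mu A = 1%E.

Definition away (e : edge) (w : config edge) :
  config {e' : edge | e' != e} := fun e' => w (val e').
Arguments away : clear implicits.

(* [f] is a version of the conditional probability of [A] given the
   sigma-algebra generated by [X]. *)
Definition is_cond_prob mu d (T : measurableType d) (X : config edge -> T)
    (A : set (config edge)) (f : config edge -> R) : Prop :=
  [/\ measurable_fun setT (f : g_sigma_algebra_preimageType X -> R),
      mu.-integrable setT (EFin \o f) &
      forall B, g_sigma_algebra_preimage X B ->
        (\int[mu]_(w in B) (f w)%:E = mu (A `&` B))%E].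

Definition finite_energy mu : Prop :=
  exists2 delta : R, 0 < delta & forall e : edge,
    exists2 f, is_cond_prob mu (away e) [set w : config edge | w e] f &
      (delta%:E <= ess_inf mu (EFin \o f))%E /\
      (ess_sup mu (EFin \o f) <= (1 - delta)%:E)%E.

End percolation_measures.

(* Main.v *)
From Stdlib Require Import Relation_Operators.
Require Import Defs.
From mathcomp Require Import all_boot all_order all_algebra.
From mathcomp Require Import all_classical all_reals all_analysis.
From mathcomp Require Import measurable_realfun ess_sup_inf zify.

Set Implicit Arguments.
Unset Strict Implicit.
Unset Printing Implicit Defensive.

Import Order.TTheory GRing.Theory Num.Theory.
Import numFieldNormedType.Exports.

Local Open Scope classical_set_scope.
Local Open Scope ring_scope.

Local Opaque generator.

(** Write H_k for the half-plane of vertices of height at least k, and suppose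
that H_0 contains an infinite cluster with positive probability.  The events
that H_k contains an infinite cluster decrease in k and all have the same
probability, so their intersection, a translation-invariant event, has
positive probability, hence probability one by ergodicity
([ae_false_or_inf]).  By self-duality the same holds for the dual.  The first
claim is therefore reduced to a statement about single configurations: [w] and
[dual w] cannot both be [typical] ([typical_contradiction]), where a typical
configuration has an infinite cluster in every H_k, finitely many infinite
clusters in the plane, and the form of horizontal stationarity that is used
below: a stationary random subset of a line is almost surely empty or
unbounded on both sides ([stationary_unbounded]).

Say that there is a ray at a vertex of line k if its cluster in H_k is
infinite.

- On no line k are there both a primal ray and a dual ray that continues by an
  open dual edge to the line below.  Otherwise both kinds are unbounded to the
  right, and as there are finitely many infinite clusters, some primal cluster
  and some dual cluster of the plane contain alternating rays p1, d1, p2, d2.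
  The four rays and two connections cannot be drawn in the plane without a
  primal-dual crossing ([crossing_rays], [ray_exclusive]).
- As all half-planes contain infinite clusters of both kinds, it follows that
  there are arbitrarily high lines k with a dual ray such that no dual ray on
  line k+1 continues to line k.  The infinite dual cluster on line k then has
  finite excursions above this line only, so it meets the line infinitely
  often; planarity and stationarity make it unbounded in both directions
  ([bi_infinite_line]).
- Such a two-sided dual cluster is a barrier: the plane cluster of a primal
  ray on a higher line stays above height k ([barrier]).  Thus there are
  infinite clusters in arbitrarily high half-planes, which is absurd if there
  are finitely many of them, since every one of them has some vertex of finite
  height.

The only input from plane topology is a parity identity for a primal and a
dual walk that do not cross ([walks_balanced]).  It counts the crossings of the
dual walk with the downward vertical rays from the ends of the primal walk, and
the crossings of the primal walk with the upward vertical rays from the ends of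
the dual walk; it is proved edge by edge.

For the second claim, finite energy implies that almost surely at most two
infinite clusters exist, by the argument of Burton and Keane with boxes in the
place of trifurcation points.  If a box meets three infinite clusters with
positive probability, then with positive probability all its inner edges are
open in addition ([insertion_null_seq]).  Such encounter boxes inject into the
boundary of any larger box ([card_encounters]); hence their density, which is
positive by translation invariance, would have to vanish
([measure_encounter]). *)

(** * Open paths, clusters and deletion of vertices *)

(** A boolean form of [open_adj], so that open walks are instances of [path].
*)
Definition adj (w : config edge) (u v : vertex) : bool :=
  [exists s, ((v == u + generator s) && w (u, s)) ||
             ((u == v + generator s) && w (v, s))].

(** Reachability by an explicit list of vertices: the planar arguments inspect
this list, and measurability is a countable union over it. *)
Definition conn (w : config edge) (u v : vertex) : Prop :=
  exists2 p, path (adj w) u p & v = last u p.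

Definition infcl (w : config edge) (u : vertex) : Prop :=
  infinite_set (cluster_of (open_edges w) u).

(** Deleting the vertices of [F] by closing their edges keeps the vertex set
fixed. Half-planes and complements of boxes are both of this form. *)
Definition avoid (F : pred vertex) (w : config edge) : config edge :=
  fun e => [&& w e, ~~ F (tail e) & ~~ F (Defs.head e)].

Lemma adjP w u v : reflect (open_adj (open_edges w) u v) (adj w u v).
Proof.
apply: (iffP existsP) => [[s /orP[]/andP[/eqP-> we]]|[[a s] we]].
- by exists (u, s) => //; left.
- by exists (v, s) => //; right.
- move=> [][-> ->]; exists s; apply/orP; [left|right];
    by apply/andP; split => //; exact/eqP.
Qed.

Lemma adjC w u v : adj w u v = adj w v u.
Proof. by apply: eq_existsb => s; rewrite orbC. Qed.

Lemma conn_refl w u : conn w u u.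
Proof. by exists [::]. Qed.

Lemma conn_adj w u v : adj w u v -> conn w u v.
Proof. by move=> uv; exists [:: v] => //=; rewrite uv. Qed.

Lemma conn_trans w v u x : conn w u v -> conn w v x -> conn w u x.
Proof.
move=> [p pp ->] [q qq ->]; exists (p ++ q); last by rewrite last_cat.
by rewrite cat_path pp.
Qed.

Lemma conn_sym w u v : conn w u v -> conn w v u.
Proof.
move=> [p pp ->]; exists (rev (belast u p)); last first.
  by case: p pp => //= a p _; rewrite rev_cons last_rcons.
by rewrite rev_path; under eq_path do rewrite adjC.
Qed.

Lemma cluster_ofP w u v : cluster_of (open_edges w) u v <-> conn w u v.
Proof.
split; last first.
  move=> [p]; elim: p u => [|a p IH] u /= => [_ ->|/andP[ua pp] vE].
    exact: rt_refl.
  by apply: (rt_trans _ _ _ a); [apply: rt_step; exact/adjP|exact: IH].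
elim => {u v} [u v /adjP|u|u v x _ + _].
- exact: conn_adj.
- exact: conn_refl.
- exact: conn_trans.
Qed.

Lemma cluster_ofE w u : cluster_of (open_edges w) u = [set v | conn w u v].
Proof. by apply/seteqP; split => v /cluster_ofP. Qed.

Lemma eq_infcl w u v : conn w u v -> infcl w u -> infcl w v.
Proof.
rewrite /infcl !cluster_ofE => uv.
suff -> : [set z | conn w u z] = [set z | conn w v z] by [].
apply/seteqP; split => x /=; last exact: conn_trans.
by apply: conn_trans; exact: conn_sym.
Qed.

Lemma adj_mono (w w' : config edge) u v :
  (forall e, w e -> w' e) -> adj w u v -> adj w' u v.
Proof.
move=> ww' /existsP[s h]; apply/existsP; exists s; move: h.
by case/orP => /andP[-> /ww' ->]; rewrite ?orbT.
Qed.

Lemma conn_mono (w w' : config edge) u v :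
  (forall e, w e -> w' e) -> conn w u v -> conn w' u v.
Proof.
move=> ww' [p pp ->]; exists p => //.
by apply: sub_path pp => x y; exact: adj_mono.
Qed.

Lemma infcl_mono (w w' : config edge) u :
  (forall e, w e -> w' e) -> infcl w u -> infcl w' u.
Proof.
move=> ww' uinf fin; apply: uinf; apply: sub_finite_set fin => v /cluster_ofP
  uv.
by apply/cluster_ofP; exact: conn_mono uv.
Qed.

Lemma avoid_sub F w e : avoid F w e -> w e.
Proof. by case/and3P. Qed.

Lemma adj_avoid F w u v :
  adj (avoid F w) u v = [&& adj w u v, ~~ F u & ~~ F v].
Proof.
apply/existsP/and3P => [[s]|[/existsP[s uv] Fu Fv]].
  rewrite /avoid /tail /Defs.head /=.
  case/orP => /andP[/eqP uv /and3P[ws Fu Fv]]; rewrite uv; split => //;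
    by apply/existsP; exists s; rewrite eqxx ws ?orbT.
exists s; case/orP: uv => /andP[/eqP uv ws]; rewrite uv eqxx /avoid /=;
  by rewrite /tail /Defs.head /= -uv ws Fu Fv ?orbT.
Qed.

Lemma conn_avoid_notin F w u v : conn (avoid F w) u v -> ~~ F u -> ~~ F v.
Proof.
move=> [p]; elim: p u => [|a p IH] u /=; first by move=> _ ->.
by rewrite adj_avoid => /andP[/and3P[_ _ Fa] pp] vE _; exact: IH pp vE Fa.
Qed.

Lemma conn_avoid F w u v : (forall z, conn w u z -> ~~ F z) ->
  conn w u v -> conn (avoid F w) u v.
Proof.
move=> + [p]; elim: p u => [|a p IH] u /=.
  by move=> _ _ ->; exact: conn_refl.
move=> uF /andP[ua pp] vE; have /IH {}IH : forall z, conn w a z -> ~~ F z.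
  by move=> z az; apply: uF; apply: conn_trans az; exact: conn_adj.
apply: conn_trans (IH pp vE); apply: conn_adj; rewrite adj_avoid ua /=.
by rewrite !uF //; [exact: conn_adj|exact: conn_refl].
Qed.

Lemma first_hit (F : pred vertex) w u v : conn w u v -> F v -> ~~ F u ->
  exists c' c, [/\ conn (avoid F w) u c', ~~ F c', adj w c' c & F c].
Proof.
move=> [p]; elim: p u => [|a p IH] u /=; first by move=> _ -> ->.
move=> /andP[ua pp] vE Fv Fu; have [Fa|Fa] := boolP (F a).
  by exists u, a; split => //; exact: conn_refl.
have [c' [c [ac' Fc' cc Fc]]] := IH _ pp vE Fv Fa.
exists c', c; split => //; apply: conn_trans ac'; apply: conn_adj.
by rewrite adj_avoid ua Fu.
Qed.

(** This is [first_hit] for the reversed walk. *)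
Lemma conn_last_exit (F : pred vertex) w b v : conn w b v -> F b -> ~~ F v ->
  exists f u, [/\ conn w b f, F f, adj w f u, ~~ F u & conn (avoid F w) u v].
Proof.
move=> /conn_sym vb Fb Fv; have [c' [c [vc' Fc' cc Fc]]] := first_hit vb Fb Fv.
exists c, c'; split => //; [|by rewrite adjC|exact: conn_sym].
apply: conn_trans (conn_sym vb) _; apply: conn_trans (conn_adj cc).
by apply: conn_mono vc'; exact: avoid_sub.
Qed.

Definition nbs (u : vertex) : seq vertex :=
  [seq u + generator s | s <- [:: true; false]] ++
  [seq u - generator s | s <- [:: true; false]].

Lemma adj_nbs w u v : adj w u v -> v \in nbs u.
Proof.
have ins (s : bool) : s \in [:: true; false] by case: s.
move=> /existsP[s] /orP[]/andP[/eqP uv _]; rewrite mem_cat; apply/orP.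
  by left; rewrite uv; apply/mapP; exists s.
by right; apply/mapP; exists s => //; rewrite uv addrK.
Qed.

(** An infinite cluster that meets [F] in finitely many vertices decomposes
into these vertices and finitely many clusters of the complement of [F],
because degrees are bounded; so one of the latter is infinite. *)
Lemma infcl_avoid (F : pred vertex) w b : F b -> infcl w b ->
    finite_set [set f | F f /\ conn w b f] ->
  exists f u, [/\ conn w b f, F f, adj w f u, ~~ F u & infcl (avoid F w) u].
Proof.
move=> Fb binf fin; apply: contrapT => H; apply: binf.
set A := [set f | _] in fin.
pose B f := \bigcup_(u in [set` nbs f] `&` [set u | adj w f u /\ ~~ F u])
  cluster_of (open_edges (avoid F w)) u.
apply: (@sub_finite_set _ _ (A `|` \bigcup_(f in A) B f)).
  move=> v /cluster_ofP bv; have [Fv|Fv] := boolP (F v); first by left.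
  have [f [u [bf Ff fu Fu uv]]] := conn_last_exit bv Fb Fv.
  right; exists f => //; exists u; last exact/cluster_ofP.
  by split => //=; exact: adj_nbs fu.
rewrite finite_setU; split => //; apply: bigcup_finite => // f [Ff bf].
apply: bigcup_finite; first exact/finite_setIl/finite_seq.
move=> u [_ [fu Fu]]; apply: contrapT => ui; apply: H.
by exists f, u.
Qed.

(** * A parity identity for non-crossing walks *)

(** Here [v] is a primal vertex and [s], [s'] are neighbouring dual vertices;
the dual vertex named (x, y) is the centre (x + 1/2, y + 1/2). Then [sweep v s
s'] says that the dual step from [s] to [s'] crosses the vertical ray downwards
from [v]: its height is the same at both ends when the first coordinates
differ. *)
Definition sweep (v s s' : vertex) : bool :=
  (s.2 < v.2) && ((s.1 < v.1) (+) (s'.1 < v.1)).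

(** Correspondingly, the primal step from [v] to [v'] crosses the vertical ray
upwards from [s]. *)
Definition pass (s v v' : vertex) : bool :=
  (s.2 < v.2) && ((s.1 < v.1) (+) (s.1 < v'.1)).

(** An infinitesimal form of the parity identity below. Moving the apex [v] of
a downward ray along a primal step changes the crossing number either because
the steps cross each other, or because an end of the dual step lies below the
primal step, in the vertical strip between the two rays. *)
Definition balanced (v v' s s' : vertex) : bool :=
  sweep v s s' (+) sweep v' s s' == pass s v v' (+) pass s' v v'.

(** The dual of an edge (x, a) joins x - generator (~~ a) to x; thus the edges
(x, a) and (y, b) cross exactly when b = ~~ a and x = y + generator b. All
orientations of the two steps are covered. *)
Lemma balanced_steps (x y : vertex) (a b : bool) :
    (b = ~~ a -> x <> y + generator b) ->
  [/\ balanced x (x + generator a) y (y + generator b),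
      balanced (x + generator a) x y (y + generator b),
      balanced x (x + generator a) (y + generator b) y &
      balanced (x + generator a) x (y + generator b) y].
Proof.
have gE c : generator c = ((~~ c)%:R : int, (c%:R : int)) by case: c.
rewrite !gE; move: a b x y => a b [x1 x2] [y1 y2] ne.
have {ne} : b = ~~ a -> x1 != y1 + (~~ b)%:R \/ x2 != y2 + b%:R.
  move=> /ne xy; apply/orP; rewrite -negb_and;
    apply/negP => /andP[/eqP e1 /eqP e2].
  by apply: xy; rewrite e1 e2.
rewrite /balanced /sweep /pass /=.
case: a; case: b => /= ne; try have {}ne := ne erefl;
  split; move: ne; rewrite /=; lia.
Qed.

Fixpoint sweeps (v s : vertex) (q : seq vertex) : bool :=
  if q is s' :: q' then sweep v s s' (+) sweeps v s' q' else false.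

Fixpoint passes (s v : vertex) (p : seq vertex) : bool :=
  if p is v' :: p' then pass s v v' (+) passes s v' p' else false.

(** Summing [balanced] over all pairs of steps, the contributions of interior
vertices cancel in both directions. The step relations are left abstract, as
the identity is used both for a primal and a dual walk and for two walks of the
same lattice. *)
Lemma walks_balanced (r r' : rel vertex) v p s q :
    (forall v v' s s', r v v' -> r' s s' -> balanced v v' s s') ->
    path r v p -> path r' s q ->
  sweeps v s q (+) sweeps (last v p) s q =
  passes s v p (+) passes (last s q) v p.
Proof.
move=> rr' + sq; elim: p v => [|v' p IH] v /=; first by rewrite addbb.
move=> /andP[vv' /IH {}IH].
suff E : sweeps v s q (+) sweeps v' s q = pass s v v' (+) pass (last s q) v v'.
  by rewrite addbACA -E -IH -addbA [X in _ = _ (+) X]addbA addbb.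
elim: q s sq {IH} => [|s' q IH] s /=; first by rewrite addbb.
move=> /andP[ss' /IH {}IH]; have /eqP E := rr' _ _ _ _ vv' ss'.
by rewrite addbACA E IH -addbA [X in _ (+) X = _]addbA addbb.
Qed.

Lemma sweeps_cat v s q q' :
  sweeps v s (q ++ q') = sweeps v s q (+) sweeps v (last s q) q'.
Proof. by elim: q s => //= a q IH s; rewrite IH addbA. Qed.

Lemma passes_cat s v p p' :
  passes s v (p ++ p') = passes s v p (+) passes s (last v p) p'.
Proof. by elim: p v => //= a p IH v; rewrite IH addbA. Qed.

(** An open edge and an open dual edge never cross. *)
Lemma balanced_dual w v v' s s' :
  adj w v v' -> adj (dual w) s s' -> balanced v v' s s'.
Proof.
move=> /existsP[a vv'] /existsP[b ss'].
have H x y : w (x, a) -> dual w (y, b) -> b = ~~ a -> x <> y + generator b.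
  move=> wx + bE xE; rewrite /dual /predual_edge /= -xE {1}bE negbK.
  by rewrite wx.
by case/orP: vv' => /andP[/eqP-> wx]; case/orP: ss' => /andP[/eqP-> wy];
  have [] := balanced_steps (H _ _ wx wy).
Qed.

(** If one of two disjoint walks of the same lattice is shifted by (1/2, 1/2),
the walks do not cross: crossing edges always share the name of an endpoint. *)
Lemma balanced_disjoint w v v' s s' :
    adj w v v' -> adj w s s' ->
    v != s -> v != s' -> v' != s -> v' != s' ->
  balanced v v' s s'.
Proof.
move=> /existsP[a vv'] /existsP[b ss'] n1 n2 n3 n4.
case/orP: vv' n1 n2 n3 n4 => /andP[/eqP-> _] n1 n2 n3 n4;
  case/orP: ss' n1 n2 n3 n4 => /andP[/eqP-> _] /eqP n1 /eqP n2 /eqP n3 /eqP n4.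
- by have [] := @balanced_steps v s a b (fun _ => n2).
- by have [] := @balanced_steps v s' a b (fun _ => n1).
- by have [] := @balanced_steps v' s a b (fun _ => n4).
- by have [] := @balanced_steps v' s' a b (fun _ => n3).
Qed.

(** * Evaluating crossing parities *)

Lemma sweeps_above v s q :
  all (fun z => v.2 <= z.2) (s :: q) -> sweeps v s q = false.
Proof.
elim: q s => //= a q IH s /and3P[sv av aq].
by rewrite IH /= ?av // /sweep ltNge sv.
Qed.

Lemma sweeps_below v s q : all (fun z : vertex => z.2 < v.2) (s :: q) ->
  sweeps v s q = (s.1 < v.1) (+) ((last s q).1 < v.1).
Proof.
elim: q s => [|a q IH] s /=; first by rewrite addbb.
move=> /and3P[sv av aq]; rewrite IH /= ?av // /sweep sv /=.
by rewrite -addbA [X in _ (+) X]addbA addbb.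
Qed.

Lemma sweeps_side v s q b :
  all (fun z => (z.1 < v.1) == b) (s :: q) -> sweeps v s q = false.
Proof.
elim: q s => //= a q IH s /and3P[/eqP sv /eqP av aq].
by rewrite IH /= ?av ?eqxx // /sweep sv av addbb andbF.
Qed.

Lemma passes_below s v p :
  all (fun z : vertex => z.2 <= s.2) (v :: p) -> passes s v p = false.
Proof.
elim: p v => //= a p IH v /and3P[sv av ap].
by rewrite IH /= ?av // /pass ltNge sv.
Qed.

Lemma passes_above s v p : all (fun z : vertex => s.2 < z.2) (v :: p) ->
  passes s v p = (s.1 < v.1) (+) (s.1 < (last v p).1).
Proof.
elim: p v => [|a p IH] v /=; first by rewrite addbb.
move=> /and3P[sv av ap]; rewrite IH /= ?av // /pass sv /=.
by rewrite -addbA [X in _ (+) X]addbA addbb.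
Qed.

Lemma passes_side s v p b :
  all (fun z => (s.1 < z.1) == b) (v :: p) -> passes s v p = false.
Proof.
elim: p v => //= a p IH v /and3P[/eqP sv /eqP av ap].
by rewrite IH /= ?av ?eqxx // /pass sv av addbb andbF.
Qed.

(** The supremum norm: only its finite balls, and the fact that it changes by
at most one along an edge, matter. *)
Definition nrm (v : vertex) : nat := maxn `|v.1|%N `|v.2|%N.

Definition bound (l : seq vertex) : nat := (\max_(z <- l) nrm z)%N.

Lemma nrm_bound l z : z \in l -> (nrm z <= bound l)%N.
Proof. by move=> zl; exact: leq_bigmax_seq. Qed.

Definition sym_interval (N : nat) : seq int :=
  [seq Posz i - Posz N | i <- iota 0 (N + N).+1].

Lemma mem_sym_interval (N : nat) (a : int) :
  (`|a| <= N)%N -> a \in sym_interval N.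
Proof.
move=> aN; apply/mapP; exists (absz (a + Posz N)); last lia.
by rewrite mem_iota; lia.
Qed.

Definition box_seq (N : nat) : seq vertex :=
  allpairs pair (sym_interval N) (sym_interval N).

Lemma mem_box_seq N v : (nrm v <= N)%N -> v \in box_seq N.
Proof.
case: v => a b; rewrite /nrm geq_max => /andP[aN bN].
by apply: allpairs_f; exact: mem_sym_interval.
Qed.

Lemma far_vertex (C : set vertex) (N : nat) :
  infinite_set C -> exists2 v, C v & (N < nrm v)%N.
Proof.
move=> Cinf; apply: contrapT => H; apply: Cinf.
apply: (@sub_finite_set _ _ [set` box_seq N]); last exact: finite_seq.
move=> v Cv; apply: mem_box_seq; rewrite leqNgt; apply/negP => vN.
by apply: H; exists v.
Qed.

(** A vertex outside of a square and not below one of its vertices is above the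
square, unless it is to the left or to the right of it. *)
Lemma above_of_far (v : vertex) (c d : int) (N : nat) : (N < nrm v)%N ->
  (`|v.1| <= N)%N -> (`|c| <= N)%N -> c <= v.2 -> (`|d| <= N)%N -> d < v.2.
Proof.
rewrite /nrm leq_max; case: v => a b /=; lia.
Qed.

(** Seen from outside of a square that contains the walk, and not from below
it, the crossings depend on the ends of the walk only: either the walk is
entirely on one side of the ray, or it is entirely below [v]. *)
Lemma sweeps_far v s q N : (N < nrm v)%N ->
    all (fun z => nrm z <= N)%N (s :: q) -> has (fun z : vertex => z.2 <= v.2)
      (s :: q) ->
  sweeps v s q = (s.1 < v.1) (+) ((last s q).1 < v.1).
Proof.
move=> vN qN /hasP[z zq zv].
have zN : (nrm z <= N)%N by exact: (allP qN).
have lN : (nrm (last s q) <= N)%N by apply: (allP qN); exact: mem_last.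
have sN : (nrm s <= N)%N by case/andP: qN.
have h y : (nrm y <= N)%N -> (`|y.1|%N <= N)%N /\ (`|y.2|%N <= N)%N.
  by rewrite /nrm geq_max => /andP.
have [[[z1 z2] [l1 l2]] [s1 s2]] := (h _ zN, h _ lN, h _ sN).
have [v1|v1] := leqP `|v.1|%N N.
  rewrite sweeps_below //; apply/allP => y /(allP qN) /h[_ y2].
  exact: above_of_far vN v1 z2 zv y2.
have [v0|v0] := ltP v.1 0.
  rewrite (@sweeps_side _ _ _ false); first lia.
  by apply/allP => y /(allP qN) /h[y1 _] /=; lia.
rewrite (@sweeps_side _ _ _ true); first lia.
by apply/allP => y /(allP qN) /h[y1 _] /=; lia.
Qed.

(** The upward ray from a point outside of a square, and not below it, does not
meet the square. *)
Lemma passes_far s v p N : (N < nrm s)%N ->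
    all (fun z => nrm z <= N)%N (v :: p) -> has (fun z : vertex => z.2 <= s.2)
      (v :: p) ->
  passes s v p = false.
Proof.
move=> vN qN /hasP[z zq zv].
have zN : (nrm z <= N)%N by exact: (allP qN).
have h y : (nrm y <= N)%N -> (`|y.1|%N <= N)%N /\ (`|y.2|%N <= N)%N.
  by rewrite /nrm geq_max => /andP.
have [z1 z2] := h _ zN.
have [v1|v1] := leqP `|s.1|%N N.
  rewrite passes_below //; apply/allP => y /(allP qN) /h[_ y2].
  exact/ltW/(above_of_far vN v1 z2 zv y2).
have [v0|v0] := ltP s.1 0.
  rewrite (@passes_side _ _ _ true) //.
  by apply/allP => y /(allP qN) /h[y1 _] /=; lia.
rewrite (@passes_side _ _ _ false) //.
by apply/allP => y /(allP qN) /h[y1 _] /=; lia.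
Qed.

Lemma path_avoid (F : pred vertex) w u p : path (adj (avoid F w)) u p ->
  path (adj w) u p /\ (~~ F (last u p) -> all (fun z => ~~ F z) (u :: p)).
Proof.
elim: p u => [|a p IH] u /=; first by move=> _; split => // ->.
rewrite adj_avoid => /andP[/and3P[ua Fu Fa] /IH[pp H]]; split.
  by rewrite ua.
by move=> /H /= ->; rewrite Fu.
Qed.

(** For a dual configuration this is the half-plane of the plaquettes above the
line of height [k]. *)
Definition hp (k : int) (w : config edge) : config edge :=
  avoid (fun v => v.2 < k) w.

Lemma conn_hp k w u v : k <= u.2 -> conn (hp k w) u v ->
  exists p, [/\ path (adj w) u p, v = last u p &
    all (fun z : vertex => k <= z.2) (u :: p)].
Proof.
move=> ku uv; have := conn_avoid_notin uv; rewrite -!leNgt => /(_ ku) kv.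
case: uv => p /path_avoid[pp H] vE; exists p; split => //.
move: H; rewrite -vE -leNgt => /(_ kv).
by apply: sub_all => z; rewrite -leNgt.
Qed.

Lemma ray_to_far w k u N : k <= u.2 -> infcl (hp k w) u ->
  exists2 e, conn (hp k w) u e & [/\ (N < nrm e)%N & k <= e.2].
Proof.
move=> ku /(@far_vertex _ N)[e /cluster_ofP ue eN]; exists e => //; split=> //.
by have := conn_avoid_notin ue; rewrite -!leNgt; exact.
Qed.

(** * Planar obstructions *)

Lemma generatorE s : generator s = ((~~ s)%:R, s%:R).
Proof. by case: s. Qed.

Lemma adj_down (w : config edge) (d k : int) :
  w ((d, k - 1), true) -> adj w (d, k) (d, k - 1).
Proof.
move=> wd; apply/existsP; exists true; apply/orP; right; rewrite wd andbT.
by rewrite generatorE /=; apply/eqP; congr pair; rewrite /= ?addr0 ?subrK.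
Qed.

Lemma lt_pred (k x : int) : k <= x -> k - 1 < x.
Proof. lia. Qed.

(** Alternating primal and dual rays that start on line [k] cannot be joined in
the plane, primal to primal and dual to dual. Applied to walks made of two long
rays and a connection, the parity identity compares the far ends of the primal
walk. There the connection of the dual rays contributes the parity of its two
ends only, and the contribution of each dual ray is carried along the primal
ray, within the half-plane, back to line [k], where it is the relative order of
the starting points. The dual rays are prolonged by one step down to line [k -
1]: without it primal rays could pass on line [k] below the first dual vertex,
whose centre has height [k + 1/2]. *)
Lemma crossing_rays (w : config edge) (k p1 p2 d1 d2 : int) :
    infcl (hp k w) (p1, k) -> infcl (hp k w) (p2, k) ->
      conn w (p1, k) (p2, k) ->
    dual w ((d1, k - 1), true) -> infcl (hp k (dual w)) (d1, k) ->
    dual w ((d2, k - 1), true) -> infcl (hp k (dual w)) (d2, k) ->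
    conn (dual w) (d1, k) (d2, k) ->
  (d1 < p1) (+) (d1 < p2) = (d2 < p1) (+) (d2 < p2).
Proof.
move=> P1 P2 P12 s1 D1 s2 D2 D12.
have {D12} [q0 q0p q0l] : conn (dual w) (d1, k - 1) (d2, k - 1).
  apply: conn_trans (conn_adj (adj_down s2)); apply: conn_trans D12.
  by apply: conn_sym; exact: conn_adj (adj_down s1).
(* The primal rays are followed until they have left a square around the dual
   connection, and afterwards the dual rays until they have left a square
   around everything primal. *)
pose N0 := bound ((d1, k - 1) :: q0).
have [e1 /conn_sym pe1 [e1N e1k]] := @ray_to_far _ k (p1, k) N0 (lexx k) P1.
have [e2 pe2 [e2N e2k]] := @ray_to_far _ k (p2, k) N0 (lexx k) P2.
have [r1 [r1p r1l r1k]] := conn_hp e1k pe1.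
have [r2 [r2p r2l r2k]] := @conn_hp k _ (p2, k) _ (lexx k) pe2.
case: P12 => r0 r0p r0l.
pose N1 := bound (e1 :: r1 ++ r0 ++ r2).
have [f1 /conn_sym sf1 [f1N f1k]] := @ray_to_far _ k (d1, k) N1 (lexx k) D1.
have [f2 sf2 [f2N f2k]] := @ray_to_far _ k (d2, k) N1 (lexx k) D2.
have [q1 [q1p q1l q1k]] := conn_hp f1k sf1.
have [q2 [q2p q2l q2k]] := @conn_hp k _ (d2, k) _ (lexx k) sf2.
pose S1 : vertex := (d1, k - 1); pose S2 : vertex := (d2, k - 1).
pose Q1 := rcons q1 S1; pose Q2 := (d2, k) :: q2 : seq vertex.
have bal := @balanced_dual w.
have Q1p : path (adj (dual w)) f1 Q1.
  by rewrite rcons_path q1p -q1l adj_down.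
have Q2p : path (adj (dual w)) S2 Q2 by rewrite /= q2p adjC adj_down.
have Q1l : last f1 Q1 = S1 by rewrite last_rcons.
have Q2l : last S2 Q2 = f2 by rewrite /= -q2l.
(* The far dual ends see no crossing of the primal walk, so both far primal ends
   see the same parity of the dual walk. *)
have tot : sweeps e1 f1 (Q1 ++ q0 ++ Q2) = sweeps e2 f1 (Q1 ++ q0 ++ Q2).
  have Pp : path (adj w) e1 (r1 ++ r0 ++ r2).
    by rewrite !cat_path r1p -r1l r0p -r0l r2p.
  have Qp : path (adj (dual w)) f1 (Q1 ++ q0 ++ Q2).
    by rewrite !cat_path Q1p Q1l q0p -q0l Q2p.
  have := walks_balanced bal Pp Qp.
  rewrite !last_cat Q1l -q0l Q2l -r1l -r0l -r2l.
  have N1P : all (fun z => nrm z <= N1)%N (e1 :: r1 ++ r0 ++ r2).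
    by apply/allP => z; exact: nrm_bound.
  have low (y : vertex) : k <= y.2 -> has (fun z : vertex => z.2 <= y.2) (e1 ::
    r1 ++ r0 ++ r2).
    move=> yk; apply/hasP; exists (p1, k) => //.
    by rewrite -cat_cons mem_cat [in X in X || _]r1l mem_last.
  rewrite (passes_far f1N N1P (low _ f1k)) (passes_far f2N N1P (low _ f2k)).
  by do 2 case: sweeps.
(* The three pieces of the dual walk, seen from the far primal ends. *)
have q0far e : (N0 < nrm e)%N -> k <= e.2 ->
    sweeps e S1 q0 = (d1 < e.1) (+) (d2 < e.1).
  have q0N : all (fun z => nrm z <= N0)%N (S1 :: q0).
    by apply/allP => z; exact: nrm_bound.
  move=> eN ek; rewrite (sweeps_far eN q0N) -?q0l //.
  apply/hasP; exists S1; first exact: mem_head.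
  exact: ltW (lt_pred ek).
have pQ1 (p : int) : sweeps (p, k) f1 Q1 = false.
  rewrite /Q1 -cats1 sweeps_cat -q1l /= /sweep /= ltxx /= !addbF.
  exact: sweeps_above.
have pQ2 (p : int) : sweeps (p, k) S2 Q2 = false.
  by rewrite /= /sweep /= addbb andbF /=; exact: sweeps_above.
have low (d : int) l : all (fun z : vertex => k <= z.2) l ->
    all (fun z : vertex => (d, k - 1).2 < z.2) l.
  by apply: sub_all => z; exact: lt_pred.
have r1N : all (fun z => nrm z <= N1)%N (e1 :: r1).
  by apply/allP => z zr; apply: nrm_bound; rewrite -cat_cons mem_cat zr.
have r2N : all (fun z => nrm z <= N1)%N ((p2, k) :: r2).
  apply/allP => z zr; apply: nrm_bound.
  have E : (p2, k) = last e1 (r1 ++ r0) by rewrite last_cat -r1l.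
  move: zr; rewrite inE catA -cat_cons mem_cat => /orP[/eqP->|->].
    by rewrite E mem_last.
  by rewrite orbT.
have r1has (y : vertex) : k <= y.2 -> has (fun z : vertex => z.2 <= y.2) (e1 ::
  r1).
  by move=> yk; apply/hasP; exists (p1, k) => //; rewrite r1l mem_last.
have r2has (y : vertex) : k <= y.2 -> has (fun z : vertex => z.2 <= y.2) ((p2,
  k) :: r2).
  by move=> yk; apply/hasP; exists (p2, k) => //; rewrite mem_head.
have e1Q1 : sweeps e1 f1 Q1 = (d1 < e1.1) (+) (d1 < p1).
  have := walks_balanced bal r1p Q1p.
  rewrite -r1l Q1l pQ1 addbF => ->.
  by rewrite (passes_far f1N r1N (r1has _ f1k)) (passes_above (low _ _ r1k))
    -r1l.
have e1Q2 : sweeps e1 S2 Q2 = (d2 < e1.1) (+) (d2 < p1).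
  have := walks_balanced bal r1p Q2p.
  rewrite -r1l Q2l pQ2 addbF => ->.
  by rewrite (passes_far f2N r1N (r1has _ f2k)) (passes_above (low _ _ r1k))
    -r1l addbF.
have e2Q1 : sweeps e2 f1 Q1 = (d1 < p2) (+) (d1 < e2.1).
  have := walks_balanced bal r2p Q1p.
  rewrite -r2l Q1l pQ1 addFb => ->.
  by rewrite (passes_far f1N r2N (r2has _ f1k)) (passes_above (low _ _ r2k))
    -r2l.
have e2Q2 : sweeps e2 S2 Q2 = (d2 < p2) (+) (d2 < e2.1).
  have := walks_balanced bal r2p Q2p.
  rewrite -r2l Q2l pQ2 addFb => ->.
  by rewrite (passes_far f2N r2N (r2has _ f2k)) (passes_above (low _ _ r2k))
    -r2l addbF.
move: tot; rewrite !sweeps_cat Q1l -q0l e1Q1 e1Q2 e2Q1 e2Q2 !q0far //.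
by do 8 case: (_ < _).
Qed.

(** A dual walk in the half-plane above line [k] joins two points of this line;
horizontally between them, a primal walk [p] leads from height at most [k] to
the origin [v] of a ray on a higher line. The ray is followed until it has left
a square around the dual walk. In the parity identity, the start of [p] has no
dual step below it, [p] does not pass above the ends of the dual walk, and the
contributions of the far end of the ray cancel. What remains is the position of
[v] relative to the two dual ends, which is odd. *)
Lemma barrier (w : config edge) (k j a b : int) (u v : vertex) p :
    u.2 <= k -> k < j -> v.2 = j -> infcl (hp j w) v ->
    path (adj w) u p -> v = last u p ->
    all (fun z : vertex => a < z.1) (u :: p) ->
    all (fun z : vertex => z.1 <= b) (u :: p) ->
  ~ conn (hp k (dual w)) (a, k) (b, k).
Proof.
move=> uk kj vj vinf pp vl pa pb ab.
have [q [qp ql qk]] := @conn_hp k _ (a, k) _ (lexx k) ab.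
pose N := bound ((a, k) :: q).
have jv : j <= v.2 by rewrite vj.
have [e ve [eN ek]] := ray_to_far N jv vinf.
have [r [rp rl rk]] := conn_hp jv ve.
have Pp : path (adj w) u (p ++ r) by rewrite cat_path pp -vl.
have := walks_balanced (@balanced_dual w) Pp qp.
rewrite last_cat -vl -rl -ql !passes_cat -vl.
rewrite sweeps_above; last by apply: sub_all qk => z; apply: le_trans.
have rk' (c : int) : all (fun z : vertex => (c, k).2 < z.2) (v :: r).
  by apply: sub_all rk => z /=; exact: lt_le_trans.
rewrite !(passes_above (rk' _)) -rl /=.
rewrite (@passes_side _ _ _ true); last first.
  by apply: sub_all pa => z /= ->.
rewrite (@passes_side _ _ _ false); last first.
  by apply: sub_all pb => z /=; rewrite ltNge => ->.
have qN : all (fun z => nrm z <= N)%N ((a, k) :: q).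
  by apply/allP => z; exact: nrm_bound.
have qh : has (fun z : vertex => z.2 <= e.2) ((a, k) :: q).
  by apply/hasP; exists (a, k); rewrite ?mem_head //=; apply: le_trans ek;
    exact: ltW.
rewrite (sweeps_far eN qN qh).
have va : a < v.1 by rewrite vl (allP pa) // mem_last.
have vb : v.1 <= b by rewrite vl (allP pb) // mem_last.
rewrite va (ltNge b) vb -ql /=.
by do 2 case: (_ < _).
Qed.

(** The steps of a walk may be restricted to the vertices of the walk; this
turns disjointness of two walks into a property of their step relations. *)
Lemma path_mem (T : eqType) (e : rel T) x p : path e x p ->
  path (fun u v => [&& e u v, u \in x :: p & v \in x :: p]) x p.
Proof.
apply: (@sub_in_path _ (mem (x :: p))); last exact/allP.
by move=> u v up vp /= ->; rewrite up vp.
Qed.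

Lemma path_conn w u p z : path (adj w) u p -> z \in u :: p -> conn w u z.
Proof.
elim: p u => [|a p IH] u /=; first by rewrite inE => _ /eqP->; exact: conn_refl.
move=> /andP[ua pp]; rewrite inE => /orP[/eqP->|zp]; first exact: conn_refl.
exact: conn_trans (conn_adj ua) (IH _ pp zp).
Qed.

(** Two walks above line [k] whose ends on this line interleave have to meet.
If they are disjoint, one of them may be viewed as a dual walk by
[balanced_disjoint]; its two ends are prolonged to line [k - 1], so that all of
the other walk is above them. *)
Lemma interleaved_conn (w : config edge) (k x1 x2 y1 y2 : int) :
    conn (hp k w) (x1, k) (x2, k) -> conn (hp k w) (y1, k) (y2, k) ->
    (y1 < x1) (+) (y1 < x2) != (y2 < x1) (+) (y2 < x2) ->
  conn (hp k w) (x1, k) (y1, k).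
Proof.
move=> xx yy ne; apply: contrapT => xy.
have hpk x p : path (adj (hp k w)) (x, k) p ->
  forall x', (x', k) = last (x, k) p ->
    all (fun z : vertex => k <= z.2) ((x, k) :: p).
  move=> /path_avoid[_ H] x' pl.
  have /H : ~~ ((last (x, k) p).2 < k) by rewrite -pl /= ltxx.
  by apply: sub_all => z; rewrite -leNgt.
case: xx => p pp pl; case: yy => q qp ql.
have [pk qk] := (hpk _ _ pp _ pl, hpk _ _ qp _ ql).
(* All edges are declared open: the two steps down need not be open in [w]. *)
pose full : config edge := fun=> true.
have sub u v : adj (hp k w) u v -> adj full u v by apply: adj_mono.
pose S1 : vertex := (y1, k - 1); pose S2 : vertex := (y2, k - 1).
pose Q : seq vertex := (y1, k) :: rcons q S2.
have Qp : path (adj full) S1 Q.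
  rewrite /= adjC adj_down //= rcons_path -ql adj_down // andbT.
  by apply: sub_path qp => u v; exact: sub.
have {}pp' : path (adj full) (x1, k) p by apply: sub_path pp => u v; exact: sub.
have disj z : z \in (x1, k) :: p -> z \notin S1 :: Q.
  move=> zp; have zk := allP pk _ zp; rewrite inE /Q -rcons_cons mem_rcons inE.
  have nz d : z <> (d, k - 1) :> vertex.
    by move=> zE; move: zk; rewrite zE /= => /lt_pred; rewrite ltxx.
  apply/negP => /or3P[/eqP/nz//|/eqP/nz//|zq]; apply: xy.
  have c1 := path_conn pp zp.
  have c2 := path_conn qp zq.
  exact: conn_trans c1 (conn_sym c2).
have bal : forall v v' s s',
    [&& adj full v v', v \in (x1, k) :: p & v' \in (x1, k) :: p] ->
    [&& adj full s s', s \in S1 :: Q & s' \in S1 :: Q] -> balanced v v' s s'.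
  move=> v v' s s' /and3P[vv' vp vp'] /and3P[ss' sq sq'].
  by apply: (balanced_disjoint vv' ss');
    [move: sq|move: sq'|move: sq|move: sq'];
    apply: contraL => /eqP <-; exact: disj.
have := walks_balanced bal (path_mem pp') (path_mem Qp).
have low (x : int) : sweeps (x, k) S1 Q = false.
  rewrite /= /sweep /= addbb andbF /= -cats1 sweeps_cat -ql /= /sweep /= ltxx.
  by rewrite /= !addbF; exact: sweeps_above.
have high (y : int) : all (fun z : vertex => (y, k - 1).2 < z.2) ((x1, k) :: p).
  by apply: sub_all pk => z; exact: lt_pred.
rewrite -pl !low /Q /= last_rcons (passes_above (high _)) (passes_above (high
  _)).
by rewrite -pl /=; move/eqP: ne; case: (_ (+) _); case: (_ (+) _).
Qed.

(** * Configurations with infinite clusters in every half-plane *)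

Definition ray_at (k : int) (w : config edge) (x : int) : Prop :=
  infcl (hp k w) (x, k).

(** The ray at (x, k) can be prolonged by one step to line [k - 1]; this is the
form of dual rays in [crossing_rays], and its absence confines the clusters
that touch line [k - 1] to finite excursions above this line. *)
Definition ray_from_below (k : int) (w : config edge) (x : int) : Prop :=
  ray_at k w x /\ w ((x, k - 1), true).

Definition right_line (k : int) (w : config edge) (x : int) : Prop :=
  forall n : int, exists2 m, n <= m & conn (hp k w) (x, k) (m, k).

Definition left_line (k : int) (w : config edge) (x : int) : Prop :=
  forall n : int, exists2 m, m <= n & conn (hp k w) (x, k) (m, k).

Definition unbounded_right (S : int -> Prop) : Prop :=
  (exists x, S x) -> forall n : int, exists2 m, n <= m & S m.

Definition unbounded_left (S : int -> Prop) : Prop :=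
  (exists x, S x) -> forall n : int, exists2 m, m <= n & S m.

(** The almost sure properties that the contradiction uses. The last four are
consequences of stationarity under horizontal translations. *)
Record typical (w : config edge) : Prop := Typical {
  typical_inf : forall k, exists2 v : vertex, k <= v.2 & infcl (hp k w) v;
  typical_fin : finite_set (infinite_clusters setT (open_edges w));
  typical_ray : forall k, unbounded_right (ray_at k w);
  typical_below : forall k, unbounded_right (ray_from_below k w);
  typical_right : forall k, unbounded_left (right_line k w);
  typical_left : forall k, unbounded_right (left_line k w) }.

Lemma finite_ubound (T : Type) (A : set T) (b : T -> int) :
  finite_set A -> exists M : int, forall x, A x -> b x <= M.
Proof.
move=> /(finite_image b) /finite_seqP[s sE].
exists (\max_(i <- s) absz i)%N => x Ax.
have xs : b x \in s by move: (imageP b Ax); rewrite sE.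
have : (absz (b x) <= \max_(i <- s) absz i)%N by exact: leq_bigmax_seq.
by move: (\max_(i <- s) _)%N (b x) => m y; lia.
Qed.

Lemma unbounded_pigeonhole (S : int -> Prop) (T : Type) (f : int -> T)
    (A : set T) : finite_set A -> (forall x, S x -> A (f x)) ->
    (forall n : int, exists2 m, n <= m & S m) ->
  exists c, forall n : int, exists2 m, n <= m & S m /\ f m = c.
Proof.
move=> Afin SA unb; apply: contrapT => H.
have /choice[b bP] : forall c, exists n : int, forall m, n <= m -> S m ->
  f m <> c.
  move=> c; apply: contrapT => Hc; apply: H; exists c => n;
    apply: contrapT => Hn.
  apply: Hc; exists n => m nm Sm fm; apply: Hn; by exists m.
have [M MP] := finite_ubound b Afin.
have [m Mm Sm] := unb M; apply: (bP (f m) m) => //.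
by apply: le_trans Mm; exact/MP/SA.
Qed.

Lemma infcl_avoid_cluster (F : pred vertex) w u :
  (forall z, conn w u z -> ~~ F z) -> infcl w u -> infcl (avoid F w) u.
Proof.
rewrite /infcl !cluster_ofE => H uinf fin; apply: uinf.
by apply: sub_finite_set fin => z /= uz; exact: conn_avoid.
Qed.

Lemma hp_avoid j k w e : avoid (fun v => v.2 < j) (hp k w) e -> hp j w e.
Proof. by case/and3P => /and3P[we _ _] h1 h2; apply/and3P. Qed.

Lemma hp_ge k w u v : k <= u.2 -> conn (hp k w) u v -> k <= v.2.
Proof. by move=> ku /conn_avoid_notin; rewrite -!leNgt; exact. Qed.

(** Rays start at the lowest vertices of an infinite cluster of a half-plane:
nothing of the cluster is lost in the smaller half-plane at their height. *)
Lemma exists_ray w k : (forall k, exists2 v : vertex, k <= v.2 & infcl (hp k w)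
  v) ->
  exists2 j, k <= j & exists x, ray_at j w x.
Proof.
move=> /(_ k)[v kv vinf].
pose P n := `[< exists2 u, conn (hp k w) v u & u.2 = k + Posz n >].
have Pv : exists n, P n.
  exists (absz (v.2 - k)); apply/asboolP; exists v; first exact: conn_refl.
  by move: (v.2) kv => y kv; lia.
case: (ex_minnP Pv) => n /asboolP[u vu un] nmin.
exists (k + Posz n); first lia.
exists u.1; rewrite /ray_at -un -surjective_pairing.
apply: infcl_mono (@hp_avoid _ _ w) _; apply: infcl_avoid_cluster; last first.
  exact: eq_infcl vu vinf.
move=> z uz; have vz := conn_trans vu uz; have kz := hp_ge kv vz.
rewrite -leNgt un; have : P (absz (z.2 - k)).
  by apply/asboolP; exists z => //; move: (z.2) kz => y kz; lia.
by move/nmin; move: (z.2) kz => y kz; lia.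
Qed.

Lemma infcl_cluster w u : infcl w u ->
  infinite_clusters setT (open_edges w) (cluster_of (open_edges w) u).
Proof. by move=> uinf; split => //; exists u. Qed.

Lemma ray_infcl k w x : ray_at k w x -> infcl w (x, k).
Proof. by apply: infcl_mono => e; exact: avoid_sub. Qed.

(** Finitely many clusters and infinitely many rays: one primal cluster
contains rays arbitrarily far to the right, and so does one dual cluster; they
can then be picked in alternating order. *)
Lemma ray_exclusive w k : typical w -> typical (dual w) ->
  (exists x, ray_at k w x) -> (exists d, ray_from_below k (dual w) d) -> False.
Proof.
move=> tw td ew ed.
have [C CP] := unbounded_pigeonhole (f := fun x => cluster_of (open_edges w)
  (x, k))
  (typical_fin tw) (fun x rx => infcl_cluster (ray_infcl rx)) (typical_ray tw
    ew).
have [D DP] := unbounded_pigeonhole (S := ray_from_below k (dual w))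
  (f := fun x => cluster_of (open_edges (dual w)) (x, k))
  (typical_fin td) (fun x rx => infcl_cluster (ray_infcl rx.1)) (typical_below
    td ed).
have clE (w' : config edge) u v :
    cluster_of (open_edges w') u = cluster_of (open_edges w') v -> conn w' u v.
  by move=> uv; apply/cluster_ofP; rewrite uv; apply/cluster_ofP/conn_refl.
have [p1 _ [P1 P1C]] := CP 0.
have [d1 pd [D1 D1C]] := DP p1.
have [p2 dp [P2 P2C]] := CP (d1 + 1).
have [d2 pd2 [D2 D2C]] := DP p2.
have P12 : conn w (p1, k) (p2, k) by apply: clE; rewrite P1C.
have D12 : conn (dual w) (d1, k) (d2, k) by apply: clE; rewrite D1C.
have := crossing_rays P1 P2 P12 D1.2 D1.1 D2.2 D2.1 D12.
by clear -pd dp pd2; lia.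
Qed.

(** Without rays from below on line [k + 1], the part of the cluster of a ray
at [x] that is strictly above line [k] splits into finite pieces, so by
[infcl_avoid] the cluster meets line [k] infinitely often and is unbounded to
the right, say. Stationarity yields further clusters of this kind that start
arbitrarily far to the left, and by [interleaved_conn] all of them coincide. *)
Lemma bi_infinite_line w k : typical w -> (exists x, ray_at k w x) ->
    ~ (exists x, ray_from_below (k + 1) w x) ->
  exists2 x, right_line k w x & left_line k w x.
Proof.
move=> tw [x xray] nobelow.
have lineinf : infinite_set [set f : vertex | f.2 < k + 1 /\ conn (hp k w) (x,
  k) f].
  move=> fin; apply: nobelow.
  have Fb : (fun v : vertex => v.2 < k + 1) (x, k) by rewrite /=; lia.
  have [f [u [bf Ff fu Fu uinf]]] := infcl_avoid Fb xray fin.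
  have kf : k <= f.2 by apply: hp_ge bf.
  move: fu; rewrite adj_avoid => /and3P[fu _ _].
  have fk : f.2 = k by move: (f.2) kf Ff => y; lia.
  case/existsP: fu => s; rewrite generatorE => /orP[]/andP[/eqP uE ws];
    last first.
    have : f.2 = u.2 + s%:R by rewrite uE.
    by move: (u.2) Fu fk => y Fu -> ; clear -Fu; case: s => /=; lia.
  have u1E : u.1 = f.1 + (~~ s)%:R by rewrite uE.
  have u2E : u.2 = f.2 + s%:R by rewrite uE.
  have sT : s by move: Fu; rewrite u2E fk; case: (s) => //=; lia.
  move: u1E u2E ws; rewrite sT /= addr0 => u1E u2E ws.
  exists f.1; split; last by rewrite addrK -fk -surjective_pairing.
  rewrite /ray_at -{2}fk -u1E -u2E -surjective_pairing.
  by apply: infcl_mono uinf => e; exact: hp_avoid.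
have far (N : nat) : exists2 m : int, (N < absz m)%N & conn (hp k w) (x, k) (m,
  k).
  have [f [f1 xf] fN] := far_vertex (N + absz k) lineinf.
  have fk : f.2 = k by have /= := hp_ge _ xf => /(_ (lexx k));
    move: (f.2) f1 => y; lia.
  exists f.1; last by rewrite -{3}fk -surjective_pairing.
  by move: fN; rewrite /nrm fk; lia.
have [xr|xr] := pselect (right_line k w x).
  exists x => // n.
  have [m mn mr] := typical_right tw (ex_intro _ x xr) (Num.min n (x - 1)).
  have [m2 xm2 mm2] := mr (x + 1).
  have [x2 mx2 xx2] := xr m2.
  exists m; first by move: mn; clear; lia.
  apply: conn_sym; apply: interleaved_conn mm2 xx2 _.
  by clear -mn xm2 mx2; lia.
have xl : left_line k w x.
  move=> n; move/existsNP: xr => [n' H].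
  have [m mN xm] := far (absz n + absz n')%N; exists m => //.
  have [n'm|] := leP n' m; first by case: H; exists m.
  by clear -mN; lia.
exists x => // n.
have [m mn ml] := typical_left tw (ex_intro _ x xl) (Num.max n (x + 1)).
have [m2 xm2 mm2] := ml (x - 1).
have [x2 mx2 xx2] := xl (m2 - 1).
exists m; first by move: mn; clear; lia.
apply: conn_sym; apply: interleaved_conn mm2 xx2 _.
by clear -mn xm2 mx2; lia.
Qed.

(** A finite walk from height at most [k] to [(v, j)] fits between two vertices
of the two-sided dual cluster of line [k]. *)
Lemma barrier_cluster w k j x v u :
    right_line k (dual w) x -> left_line k (dual w) x -> k < j ->
    ray_at j w v -> conn w (v, j) u -> k < u.2.
Proof.
move=> xr xl kj vj /conn_sym[p pp pl]; rewrite ltNge; apply/negP => uk.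
pose N := bound (u :: p).
have [b Nb xb] := xr (Posz N).
have [a aN xa] := xl (- Posz N - 1).
have pN z : z \in u :: p -> (`|z.1| <= N)%N.
  by move=> /nrm_bound; apply: leq_trans; rewrite /nrm leq_maxl.
apply: (barrier uk kj _ vj pp pl (a := a) (b := b)) => //.
- apply/allP => z /pN; move: (z.1) => y; clear -aN; lia.
- apply/allP => z /pN; move: (z.1) => y; clear -Nb; lia.
- exact: conn_trans (conn_sym xa) xb.
Qed.

(** Above any height [k0] there is a line with dual rays whose next line has no
dual ray from below; otherwise all lines from some height on would carry dual
rays from below, and by [ray_exclusive] no primal rays. *)
Lemma typical_contradiction w : typical w -> typical (dual w) -> False.
Proof.
move=> tw td.
have high (k0 : int) : exists2 u, infcl w u & forall z, conn w u z -> k0 < z.2.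
  have [k k0k [ek nk]] : exists2 k, k0 <= k & (exists x, ray_at k (dual w) x) /\
      ~ (exists x, ray_from_below (k + 1) (dual w) x).
    apply: contrapT => H.
    have next k : k0 <= k -> (exists x, ray_at k (dual w) x) ->
        exists x, ray_from_below (k + 1) (dual w) x.
      by move=> k0k ek; apply: contrapT => nk; apply: H; exists k.
    have [k1 k01 e1] := exists_ray k0 (typical_inf td).
    have all_below (n : nat) : exists x, ray_from_below (k1 + 1 + n%:Z) (dual
      w) x.
      elim: n => [|n [x [xr _]]]; first by rewrite addr0; exact: next.
      rewrite -addn1 PoszD addrA; apply: next; last by exists x.
      by clear -k01; lia.
    have [j k1j ej] := exists_ray (k1 + 1) (typical_inf tw).
    apply: (ray_exclusive tw td ej).
    have -> : j = k1 + 1 + (absz (j - k1 - 1)%R)%:Z by clear -k1j; lia.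
    exact: all_below.
  have [x xr xl] := bi_infinite_line td ek nk.
  have [j kj [v vj]] := exists_ray (k + 1) (typical_inf tw).
  exists (v, j); first exact: ray_infcl vj.
  move=> z vz; apply: le_lt_trans k0k _.
  by apply: barrier_cluster xr xl _ vj vz; clear -kj; lia.
have /choice[h hP] : forall C : set vertex, exists v, infinite_set C -> C v.
  move=> C; have [Cinf|Cfin] := pselect (infinite_set C); last by exists (0, 0).
  by have [v Cv _] := far_vertex 0 Cinf; exists v.
have [M MP] := finite_ubound (fun C => (h C).2) (typical_fin tw).
have [u uinf uM] := high M.
have := MP _ (infcl_cluster uinf); rewrite leNgt => /negP; apply.
by apply: uM; apply/cluster_ofP; exact: hP.
Qed.

(** * Measurable events and translations *)

Section events.
Context d (T : measurableType d).

Lemma measurable_exists (U : countType) (P : U -> T -> Prop) :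
  (forall u, measurable [set w | P u w]) -> measurable [set w | exists u, P u
    w].
Proof.
move=> mP; have -> : [set w | exists u, P u w] = \bigcup_u [set w | P u w].
  by apply/seteqP; split => w [u]; [exists u|move=> _; exists u].
by apply: countable_bigcupT_measurable => //; exact: countableP.
Qed.

Lemma measurable_not (P : T -> Prop) :
  measurable [set w | P w] -> measurable [set w | ~ P w].
Proof. exact: measurableC. Qed.

Lemma measurable_and (P Q : T -> Prop) : measurable [set w | P w] ->
  measurable [set w | Q w] -> measurable [set w | P w /\ Q w].
Proof. exact: measurableI. Qed.

Lemma measurable_or (P Q : T -> Prop) : measurable [set w | P w] ->
  measurable [set w | Q w] -> measurable [set w | P w \/ Q w].
Proof. exact: measurableU. Qed.

Lemma measurable_forall (U : countType) (P : U -> T -> Prop) :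
  (forall u, measurable [set w | P u w]) -> measurable [set w | forall u, P u
    w].
Proof.
move=> mP.
have -> : [set w | forall u, P u w] = [set w | ~ exists u, ~ P u w].
  apply/seteqP; split => w /= H; first by move=> [u]; apply; exact: H.
  by move=> u; apply: contrapT => Pu; apply: H; exists u.
by apply/measurable_not/measurable_exists => u; exact: measurable_not.
Qed.

Lemma measurable_const (P : Prop) : measurable [set w : T | P].
Proof.
have [p|np] := pselect P.
  by rewrite (_ : [set _ | _] = setT) //; apply/seteqP; split.
by rewrite (_ : [set _ | _] = set0) //; apply/seteqP; split.
Qed.

Lemma measurable_ifb (b : bool) (P : T -> Prop) :
  measurable [set w | P w] -> measurable [set w | b /\ P w].
Proof. by move=> mP; apply: measurable_and => //; exact: measurable_const. Qed.

End events.

Lemma measurable_pre d d' (S : measurableType d) (T : measurableType d')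
    (f : S -> T) (A : set T) :
  measurable_fun setT f -> measurable A -> measurable (f @^-1` A).
Proof. by move=> mf mA; rewrite -[X in measurable X]setTI; exact: mf. Qed.

Lemma measurable_open (I : choiceType) (e : I) :
  measurable [set w : config I | w e].
Proof.
apply: sub_sigma_algebra.
have : continuous (fun w : prod_topology (fun _ : I => bool) => w e).
  exact: (@proj_continuous I (fun=> bool) e).
move=> /continuousP/(_ [set true]); rewrite /preimage /=; apply.
exact: discrete_open.
Qed.

Lemma measurable_adj u v : measurable [set w | adj w u v].
Proof.
have -> : [set w | adj w u v] = [set w | exists s : bool,
   (v == u + generator s /\ w (u, s)) \/ (u == v + generator s /\ w (v, s))].
  apply/seteqP; split => w /=.
    by move=> /existsP[s /orP[]/andP[? ?]]; exists s; [left|right].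
  move=> [s [] [uv ws]]; apply/existsP; exists s; rewrite uv ws ?orbT //.
apply: measurable_exists => s.
by apply: measurable_or; apply: measurable_ifb; exact: measurable_open.
Qed.

Lemma measurable_conn u v : measurable [set w | conn w u v].
Proof.
have -> : [set w | conn w u v] =
    [set w | exists p, v == last u p /\ path (adj w) u p].
  by apply/seteqP; split => w [p]; [move=> pp ->; exists p|
    move=> [/eqP-> pp]; exists p].
apply: measurable_exists => p; apply: measurable_ifb.
elim: p u => [|a p IH] u /=; first exact: measurable_const.
have -> : [set w | adj w u a && path (adj w) a p] =
    [set w | adj w u a /\ path (adj w) a p].
  by apply/seteqP; split => w /andP.
by apply: measurable_and; [exact: measurable_adj|exact: IH].
Qed.

(** Infinite means not contained in any finite list of vertices, and there are
countably many such lists. *)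
Lemma measurable_infcl u : measurable [set w | infcl w u].
Proof.
have -> : [set w | infcl w u] =
    [set w | forall s : seq vertex, exists v, v \notin s /\ conn w u v].
  apply/seteqP; split => w /=; rewrite /infcl cluster_ofE.
    move=> winf s; apply: contrapT => H; apply: winf.
    apply: (@sub_finite_set _ _ [set` s]); last exact: finite_seq.
    by move=> v uv /=; apply: contrapT => /negP vs; apply: H; exists v.
  move=> H /finite_seqP[s sE]; have [v [/negP vs uv]] := H s; apply: vs.
  by have : [set` s] v by rewrite -sE.
apply: measurable_forall => s; apply: measurable_exists => v.
by apply: measurable_ifb; exact: measurable_conn.
Qed.

Lemma measurable_avoid (F : pred vertex) : measurable_fun setT (avoid F).
Proof.
apply: measurable_config => e; exists e.
by exists (fun b => [&& b, ~~ F (tail e) & ~~ F (Defs.head e)]).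
Qed.

Lemma measurable_translate v : measurable_fun setT (translate v).
Proof. by apply: measurable_config => e; exists (e.1 - v, e.2), id. Qed.

Lemma translateD u v w : translate u (translate v w) = translate (u + v) w.
Proof. by apply/funext => e; rewrite /translate /= opprD addrA. Qed.

Lemma adj_translate t w u v : adj (translate t w) u v = adj w (u - t) (v - t).
Proof.
apply: eq_existsb => s; rewrite /translate /=.
by congr (_ && _ || _ && _); rewrite addrAC (inj_eq (addIr _)).
Qed.

Lemma conn_translate t w u v : conn (translate t w) u v <->
  conn w (u - t) (v - t).
Proof.
split=> [[p]|].
  elim: p u => [|a p IH] u /=; first by move=> _ ->; exact: conn_refl.
  rewrite adj_translate => /andP[ua pp] /(IH _ pp); apply: conn_trans.
  exact: conn_adj.
move=> [p]; move uE : (u - t) => u' pp; elim: p u u' uE pp => [|a p IH] u u' uE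
  /=.
  by move=> _ /eqP; rewrite -uE (inj_eq (addIr _)) => /eqP->; exact: conn_refl.
move=> /andP[ua pp] vE; have aE : a + t - t = a by rewrite addrK.
apply: conn_trans (IH _ _ aE pp vE); apply: conn_adj.
by rewrite adj_translate aE uE.
Qed.

Lemma infcl_translate t w u : infcl (translate t w) u <-> infcl w (u - t).
Proof.
rewrite /infcl !cluster_ofE; split => H fin; apply: H.
  apply: (@sub_finite_set _ _ [set v + t | v in [set v | conn w (u - t) v]]);
    last exact: finite_image.
  by move=> v /= /conn_translate uv; exists (v - t) => //; rewrite subrK.
apply: (@sub_finite_set _ _
    [set v - t | v in [set v | conn (translate t w) u v]]);
  last exact: finite_image.
move=> v /= uv; exists (v + t); last by rewrite addrK.
by apply/conn_translate; rewrite addrK.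
Qed.

Lemma avoid_translate F t w : avoid F (translate t w) =
  translate t (avoid (fun v => F (v + t)) w).
Proof.
apply/funext => -[e s].
by rewrite /avoid /translate /tail /Defs.head /= subrK (addrAC _ (generator s))
  subrK.
Qed.

Lemma hp_translate k t w : hp k (translate t w) = translate t (hp (k - t.2) w).
Proof.
rewrite /hp avoid_translate; congr (translate t (avoid _ w)).
by apply/funext => v /=; rewrite -ltrBrDr.
Qed.

(** * Mean counts and stationarity *)

(** The expectation of the number of events that occur. *)
Lemma sum_probability_le d (T : measurableType d) (R : realType)
    (P : probability T R) (J : finType) (B : J -> set T) (K : nat) :
    (forall i, measurable (B i)) ->
    (forall w, \sum_(i : J) `[< B i w >] <= K)%N ->
  (\sum_(i : J) P (B i) <= K%:R%:E)%E.
Proof.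
move=> mB count.
have -> : (\sum_(i : J) P (B i) = \sum_(i <- enum J) \int[P]_w (\1_(B i)
  w)%:E)%E.
  rewrite big_enum /=; apply: eq_bigr => i _.
  by rewrite integral_indic // setIT.
have m1 i : measurable_fun setT (EFin \o \1_(B i) : T -> \bar R).
  by apply/measurable_EFinP; exact: measurable_indic.
rewrite -(ge0_integral_sum P measurableT m1) => [|i w _];
  last by rewrite lee_fin.
have -> : (K%:R%:E = \int[P]_w cst K%:R%:E w :> \bar R)%E.
  rewrite integral_cst //.
  by rewrite -[LHS]mule1; congr (_ * _)%E; exact: (esym (probability_setT P)).
apply: ge0_le_integral => //.
- by move=> w _; apply: sume_ge0 => i _; rewrite lee_fin.
- by apply: emeasurable_sum => i; exact: m1.
- move=> w _; rewrite sumEFin lee_fin /=.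
  have -> : \sum_(i <- enum J) \1_(B i) w =
      (\sum_(i : J) `[< B i w >])%N%:R :> R.
    rewrite natr_sum big_enum /=; apply: eq_bigr => i _.
    by rewrite indicE; congr (_%:R); congr nat_of_bool; apply/idP/idP;
      rewrite inE => /asboolP; try exact/asboolP.
  by rewrite ler_nat.
Qed.

Lemma mean_count (R : realType) (mu : probability (config edge) R)
    (A : set (config edge)) (J : finType) (t : J -> vertex) (K : nat) :
    translation_invariant mu -> measurable A ->
    (forall w, \sum_(i : J) `[< A (translate (t i) w) >] <= K)%N ->
  (#|J|%:R%:E * mu A <= K%:R%:E)%E.
Proof.
move=> inv mA count.
have mB i : measurable (translate (t i) @^-1` A).
  by apply: measurable_pre mA; exact: measurable_translate.
apply: le_trans (sum_probability_le mu mB count).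
rewrite (eq_bigr (fun=> mu A)) => [|i _]; last exact: inv.
by rewrite sumr_const mule_natl.
Qed.

Lemma archi_null (R : realType) (x c : R) :
  0 <= x -> (forall n : nat, n%:R * x <= c) -> x = 0.
Proof.
move=> x0 H; apply/eqP; rewrite eq_le x0 andbT leNgt; apply/negP => xp.
have := H (Num.bound (c / x)); rewrite leNgt => /negP; apply.
rewrite -ltr_pdivrMr //; apply: archi_boundP.
by rewrite divr_ge0 //; apply: le_trans (H 0); rewrite mul0r.
Qed.

Lemma ae_forall (R : realType) (mu : probability (config edge) R)
    (U : countType) (P : U -> config edge -> Prop) :
  (forall u, {ae mu, forall w, P u w}) -> {ae mu, forall w, forall u, P u w}.
Proof.
move=> H.
pose Q n w := if unpickle n is Some u then P u w else True.
have : {ae mu, forall w, forall n, Q n w}.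
  by apply: ae_foralln => n; rewrite /Q; case: unpickle => //; exact: aeW.
by apply: filterS => w Hw u; have := Hw (pickle u); rewrite /Q pickleK.
Qed.

Lemma ae_null (R : realType) (mu : probability (config edge) R)
    (A : set (config edge)) :
  measurable A -> mu A = 0%E -> {ae mu, forall w, ~ A w}.
Proof.
move=> mA A0; exists A; split => //; move=> w /= H.
by apply: contrapT => Aw; apply: H.
Qed.

(** The positions of the last points of the random set are disjoint events of
equal probability, so almost surely there is no last point. *)
Lemma stationary_unbounded (R : realType) (mu : probability (config edge) R)
    (A : set (config edge)) (t : vertex) :
    translation_invariant mu -> measurable A ->
  {ae mu, forall w, unbounded_right (fun x : int => A (translate (t *~ x) w))}.
Proof.
move=> inv mA.
pose L : set (config edge) :=
  [set w | A w /\ forall m : nat, ~ A (translate (t *~ (m.+1%:Z)) w)].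
have mL : measurable L.
  apply: (@measurableI _ _ A [set w | forall m : nat, ~ A _]) => //.
  apply: measurable_forall => m; apply: measurable_not.
  by apply: (measurable_pre _ mA); exact: measurable_translate.
have L0 : mu L = 0%E.
  have Lfin : mu L \is a fin_num by exact: fin_num_measure.
  rewrite -(fineK Lfin); congr EFin; apply: (@archi_null _ _ 1).
    by rewrite fine_ge0.
  move=> n; rewrite -lee_fin EFinM (fineK Lfin).
  have disj (i j : nat) w : (i < j)%N ->
      L (translate (t *~ i%:Z) w) -> L (translate (t *~ j%:Z) w) -> False.
    move=> ij [_ Li] [Lj _]; apply: (Li (j - i).-1).
    rewrite translateD -mulrzDr (_ : _ + _ = j%:Z) //.
    by clear -ij; lia.
  have count w : (\sum_(i : 'I_n) `[< L (translate (t *~ (i : nat)%:Z) w) >] <=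
    1)%N.
    have [[i Li]|no] := pselect (exists i : 'I_n, L (translate (t *~ (i :
      nat)%:Z) w)).
      rewrite (bigD1 i) //= big1 ?addn0 ?leq_b1 // => j /eqP ji.
      apply/eqP; rewrite eqb0; apply/negP => /asboolP Lj.
      have [ij|ij|/val_inj/esym //] := ltngtP i j.
        exact: disj ij Li Lj.
      exact: disj ij Lj Li.
    rewrite big1 // => j _; apply/eqP; rewrite eqb0; apply/negP => /asboolP Lj.
    by apply: no; exists j.
  by have := mean_count inv mL count; rewrite card_ord.
have all : {ae mu, forall w, forall n : int, ~ L (translate (t *~ n) w)}.
  apply: ae_forall => n.
  apply: (@ae_null _ _ (translate (t *~ n) @^-1` L)); last by rewrite inv.
  by apply: measurable_pre => //; exact: measurable_translate.
apply: filterS all => w noL [x0 x0A] n; apply: contrapT => H.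
pose P j := `[< A (translate (t *~ (n - Posz j)) w) >].
have Px : exists j, P j.
  exists (absz (n - x0)%R); apply/asboolP.
  have [nx|xn] := leP n x0; first by case: H; exists x0.
  by have -> : n - (absz (n - x0)%R)%:Z = x0 by clear -xn; lia.
case: (ex_minnP Px) => j /asboolP Pj jmin; apply: (noL (n - j%:Z));
  split => // m.
rewrite translateD -mulrzDr => Am.
have [nm|mn] := leP n (m.+1%:Z + (n - j%:Z)).
  by apply: H; exists (m.+1%:Z + (n - j%:Z)).
have : P (j - m.+1)%N.
  by apply/asboolP; rewrite (_ : n - _ = m.+1%:Z + (n - j%:Z)) //; clear -mn;
    lia.
by move=> /jmin; clear -mn; lia.
Qed.

(** * Almost every configuration is typical *)

(** This identifies the multiples of a unit vector in [stationary_unbounded]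
with the horizontal shifts by which the properties of rays are transported. *)
Lemma vertex_mulrz (a b x : int) : ((a, b) : vertex) *~ x = (a * x, b * x).
Proof.
by rewrite [LHS]surjective_pairing (raddfMz (@fst int int)) (raddfMz (@snd int
  int))
  /= !mulrzz.
Qed.

Lemma hp_shift k (x : int) w : hp k (translate (x, 0) w) = translate (x, 0) (hp
  k w).
Proof. by rewrite hp_translate subr0. Qed.

Lemma ray_at_shift k (x y : int) w :
  ray_at k (translate (x, 0) w) y <-> ray_at k w (y - x).
Proof. by rewrite /ray_at hp_shift infcl_translate /= -[_ - (x, 0)]/(y - x, k -
  0) subr0. Qed.

Lemma conn_shift k (x y z : int) w : conn (hp k (translate (x, 0) w)) (y, k)
  (z, k)
  <-> conn (hp k w) (y - x, k) (z - x, k).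
Proof.
rewrite hp_shift conn_translate.
by rewrite -[(y, k) - (x, 0)]/(y - x, k - 0) -[(z, k) - (x, 0)]/(z - x, k - 0)
  subr0.
Qed.

Lemma right_line_shift k (x y : int) w :
  right_line k (translate (x, 0) w) y <-> right_line k w (y - x).
Proof.
split=> H n.
  have [m nm /conn_shift ym] := H (n + x); exists (m - x) => //.
  by rewrite lerBrDr.
have [m nm ym] := H (n - x); exists (m + x); first by rewrite -lerBlDr.
by apply/conn_shift; rewrite addrK.
Qed.

Lemma left_line_shift k (x y : int) w :
  left_line k (translate (x, 0) w) y <-> left_line k w (y - x).
Proof.
split=> H n.
  have [m nm /conn_shift ym] := H (n + x); exists (m - x) => //.
  by rewrite lerBlDr.
have [m nm ym] := H (n - x); exists (m + x); first by rewrite -lerBrDr.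
by apply/conn_shift; rewrite addrK.
Qed.

Lemma measurable_ray_at k x : measurable [set w | ray_at k w x].
Proof. exact: (measurable_pre (measurable_avoid _) (measurable_infcl (x, k))).
  Qed.

Lemma measurable_ray_from_below k x : measurable [set w | ray_from_below k w x].
Proof.
apply: (@measurableI _ _ [set w | ray_at k w x] [set w | w ((x, k - 1), true)]).
  exact: measurable_ray_at.
exact: measurable_open.
Qed.

Lemma measurable_conn_hp k u v : measurable [set w | conn (hp k w) u v].
Proof. exact: (measurable_pre (measurable_avoid _) (measurable_conn u v)). Qed.

Lemma measurable_right_line k x : measurable [set w | right_line k w x].
Proof.
have -> : [set w | right_line k w x] =
    [set w | forall n : int, exists m, n <= m /\ conn (hp k w) (x, k) (m, k)].
  by apply/seteqP; split => w H n; have [m] := H n;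
    [exists m|move=> [nm xm]; exists m].
apply: measurable_forall => n; apply: measurable_exists => m.
by apply: measurable_ifb; exact: measurable_conn_hp.
Qed.

Lemma measurable_left_line k x : measurable [set w | left_line k w x].
Proof.
have -> : [set w | left_line k w x] =
    [set w | forall n : int, exists m, m <= n /\ conn (hp k w) (x, k) (m, k)].
  by apply/seteqP; split => w H n; have [m] := H n;
    [exists m|move=> [nm xm]; exists m].
apply: measurable_forall => n; apply: measurable_exists => m.
by apply: measurable_ifb; exact: measurable_conn_hp.
Qed.

Definition hp_inf (k : int) (w : config edge) : Prop :=
  exists2 v : vertex, k <= v.2 & infcl (hp k w) v.

Section typical_almost_surely.
Context (R : realType) (mu : probability (config edge) R).
Hypothesis inv : translation_invariant mu.

Lemma ae_unbounded_right (A : int -> config edge -> Prop) :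
    measurable [set w | A 0 w] ->
    (forall x w, A 0 (translate (- x, 0) w) <-> A x w) ->
  {ae mu, forall w, unbounded_right (A^~ w)}.
Proof.
move=> mA AE; have := stationary_unbounded (-1, 0) inv mA.
apply: filterS => w H [x xA] n.
have E y : A 0 (translate ((-1, 0) *~ y) w) <-> A y w.
  by rewrite vertex_mulrz mulN1r mul0r.
have [|m nm Am] := H _ n; first by exists x; exact/E.
by exists m => //; exact/E.
Qed.

Lemma ae_unbounded_left (A : int -> config edge -> Prop) :
    measurable [set w | A 0 w] ->
    (forall x w, A 0 (translate (- x, 0) w) <-> A x w) ->
  {ae mu, forall w, unbounded_left (A^~ w)}.
Proof.
move=> mA AE; have := stationary_unbounded (1, 0) inv mA.
apply: filterS => w H [x xA] n.
have E y : A 0 (translate ((1, 0) *~ y) w) <-> A (- y) w.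
  by have := AE (- y) w; rewrite vertex_mulrz mul1r mul0r opprK.
have [|m nm Am] := H _ (- n); first by exists (- x); apply/E; rewrite opprK.
by exists (- m); [rewrite lerNl|exact/E].
Qed.

Lemma ae_typical :
    {ae mu, forall w, finite_set (infinite_clusters setT (open_edges w))} ->
    {ae mu, forall w, forall k, hp_inf k w} ->
  {ae mu, forall w, typical w}.
Proof.
move=> fin inf.
have H1 : {ae mu, forall w, forall k, unbounded_right (ray_at k w)}.
  apply: ae_forall => k; apply: ae_unbounded_right;
    first exact: measurable_ray_at.
  by move=> x w; have := ray_at_shift k (- x) 0 w; rewrite sub0r opprK.
have H2 : {ae mu, forall w, forall k, unbounded_right (ray_from_below k w)}.
  apply: ae_forall => k; apply: ae_unbounded_right.
    exact: measurable_ray_from_below.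
  move=> x w; rewrite /ray_from_below; have := ray_at_shift k (- x) 0 w.
  rewrite /translate /= -[(0, k - 1) - _]/(0 - - x, k - 1 - 0).
  by rewrite sub0r opprK subr0 => ->.
have H3 : {ae mu, forall w, forall k, unbounded_left (right_line k w)}.
  apply: ae_forall => k; apply: ae_unbounded_left;
    first exact: measurable_right_line.
  by move=> x w; have := right_line_shift k (- x) 0 w; rewrite sub0r opprK.
have H4 : {ae mu, forall w, forall k, unbounded_right (left_line k w)}.
  apply: ae_forall => k; apply: ae_unbounded_right;
    first exact: measurable_left_line.
  by move=> x w; have := left_line_shift k (- x) 0 w; rewrite sub0r opprK.
by near=> w; split; near: w.
Unshelve. all: by end_near.
Qed.

End typical_almost_surely.

(** * The zero-one law and the half-plane marginal *)

Lemma measurable_hp_inf k : measurable [set w | hp_inf k w].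
Proof.
have -> : [set w | hp_inf k w] =
    [set w | exists v : vertex, k <= v.2 /\ infcl (hp k w) v].
  by apply/seteqP; split => w [v]; [exists v|move=> [kv vinf]; exists v].
apply: measurable_exists => v; apply: measurable_ifb.
exact: (measurable_pre (measurable_avoid _) (measurable_infcl v)).
Qed.

Lemma hp_inf_translate k t w : hp_inf k (translate t w) <-> hp_inf (k - t.2) w.
Proof.
rewrite /hp_inf hp_translate; split=> -[v kv].
  by move=> /infcl_translate vinf; exists (v - t) => //; rewrite lerD2r.
move=> vinf; exists (v + t); first by rewrite -lerBlDr.
by apply/infcl_translate; rewrite addrK.
Qed.

Lemma hp_inf_mono j k w : j <= k -> hp_inf k w -> hp_inf j w.
Proof.
move=> jk [v kv vinf]; exists v; first exact: le_trans kv.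
apply: infcl_mono vinf => e /and3P[we h1 h2]; apply/and3P; split => //.
  by move: h1; rewrite -!leNgt; exact: le_trans.
by move: h2; rewrite -!leNgt; exact: le_trans.
Qed.

Section half_plane_clusters.
Context (R : realType) (mu : probability (config edge) R).
Hypothesis inv : translation_invariant mu.

(** A decreasing sequence of events of equal probability is almost surely
constant. *)
Lemma ae_hp_inf_all : {ae mu, forall w, hp_inf 0 w -> forall k, hp_inf k w}.
Proof.
have H : {ae mu, forall w, forall k : int, ~ (hp_inf 0 w /\ ~ hp_inf k w)}.
  apply: ae_forall => k; have [k0|k0] := leP k 0.
    by apply: aeW => w [w0]; apply; exact: hp_inf_mono w0.
  have m0 := measurable_hp_inf 0; have mk := measurable_hp_inf k.
  apply: (@ae_null _ _ ([set w | hp_inf 0 w] `\` [set w | hp_inf k w])).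
    exact: measurableD.
  have kE : mu [set w | hp_inf k w] = mu [set w | hp_inf 0 w].
    rewrite -(inv (0, k) mk); congr (mu _).
    by apply/seteqP; split => w /=; rewrite hp_inf_translate subrr.
  have m0fin : (mu [set w | hp_inf 0 w] < +oo)%E by rewrite ltey_eq
    fin_num_measure.
  rewrite measureD // (_ : _ `&` _ = [set w | hp_inf k w]).
    apply: (etrans (congr1 (fun x => mu [set w | hp_inf 0 w] - x)%E kE)).
    by rewrite subee // fin_num_measure.
  apply/seteqP; split => w /=; first by case.
  by move=> wk; split => //; apply: hp_inf_mono wk; exact: ltW.
apply: filterS H => w H w0 k; apply: contrapT => wk; exact: (H k).
Qed.

Lemma ae_false_or_inf : ergodic mu ->
  {ae mu, forall w, ~ hp_inf 0 w} \/ {ae mu, forall w, forall k, hp_inf k w}.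
Proof.
move=> erg; pose E : set (config edge) := [set w | forall k, hp_inf k w].
have mE : measurable E by apply: measurable_forall => k;
  exact: measurable_hp_inf.
have invE v : translate v @^-1` E = E.
  apply/seteqP; split => w /= H k.
    by have /hp_inf_translate := H (k + v.2); rewrite addrK.
  by apply/hp_inf_translate.
have [E0|E1] := erg E mE invE; [left|right].
  have notE := ae_null mE E0; have all := ae_hp_inf_all.
  by apply: filterS2 notE all => w nE H w0; apply: nE; exact: H.
have mCE := measurableC mE.
have CE0 : mu (~` E) = 0%E by rewrite probability_setC // E1 subee.
by apply: filterS (ae_null mCE CE0) => w /= /contrapT.
Qed.

Lemma ae_dual (P : config edge -> Prop) : self_dual mu ->
  {ae mu, forall w, P w} -> {ae mu, forall w, P (dual w)}.
Proof.
move=> sd [N [mN N0 PN]]; exists (dual @^-1` N); split.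
- by apply: measurable_pre => //; exact: measurable_dual.
- by have := sd N mN; rewrite N0.
- by move=> w /= Pw; exact: PN.
Qed.

Lemma ae_hp_inf0 : self_dual mu -> ergodic mu ->
    {ae mu, forall w, finite_set (infinite_clusters setT (open_edges w))} ->
  {ae mu, forall w, ~ hp_inf 0 w}.
Proof.
move=> sd erg fin; have [//|inf] := ae_false_or_inf erg.
have typ := ae_typical inv fin inf.
apply: filterS2 typ (ae_dual sd typ) => w tw tdw.
by case: (typical_contradiction tw tdw).
Qed.

End half_plane_clusters.

(** A measurable section of [hp_restrict], by which events on half-plane
configurations become events on configurations of the plane. *)
Definition hp_extend (w : config hp_edge) : config edge :=
  fun e => if insub e is Some e' then w e' else false.

Lemma measurable_hp_extend : measurable_fun setT hp_extend.
Proof.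
apply: measurable_config => e; rewrite /hp_extend.
case: insubP => [e' _ _|_]; first by exists e', id.
have up : upper (tail ((0, 0), true)) && upper (Defs.head ((0, 0), true)).
  by [].
by exists (Sub ((0, 0), true) up), (fun=> false).
Qed.

Lemma open_edges_hp_extend w : open_edges (hp_extend w) = hp_open_edges w.
Proof.
apply/seteqP; split => e /=; rewrite /open_edges /= /hp_extend.
  by case: insubP => // e' _ <- we'; exists e'.
by move=> [e' we' <-]; rewrite valK.
Qed.

Lemma hp_extend_restrict w : hp_extend (hp_restrict w) = hp 0 w.
Proof.
apply/funext => e; rewrite /hp_extend /hp_restrict /hp /avoid -!leNgt.
case: insubP => [e' He ->|]; first by rewrite He andbT.
by rewrite /upper => /negbTE ->; rewrite andbF.
Qed.

Lemma hp_marginal_no_cluster (R : realType) (mu : probability (config edge) R) :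
    {ae mu, forall w, ~ hp_inf 0 w} ->
  {ae hp_marginal mu, forall w,
      infinite_clusters [set` upper] (hp_open_edges w) = set0}.
Proof.
move=> H; pose B : set (config edge) := [set w | exists v, upper v /\ infcl w
  v].
have mB : measurable B.
  by apply: measurable_exists => v; apply: measurable_ifb;
    exact: measurable_infcl.
exists (hp_extend @^-1` B); split.
- exact: measurable_pre measurable_hp_extend mB.
- rewrite (_ : hp_marginal _ _ = mu [set w | hp_inf 0 w]).
    apply/negligibleP; first exact: measurable_hp_inf.
    by apply: negligibleS H => w /= w0; apply.
  congr (mu _); apply/seteqP; split => w /=; rewrite hp_extend_restrict.
    by move=> [v [v0 vinf]]; exists v.
  by move=> [v v0 vinf]; exists v.
- move=> w /=; rewrite -open_edges_hp_extend => H'; apply: contrapT => nB;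
    apply: H'.
  apply/seteqP; split => // C [[v v0 vC] Cinf]; apply: nB; exists v;
    split => //.
  by rewrite /infcl vC.
Qed.

(** * Counting encounter sets *)

(** [u] is where a walk that leaves [B] continues; its cluster in the
complement of [B] is one of the parts into which the deletion of [B] cuts the
cluster. *)
Definition branch (w : config edge) (B : pred vertex) (u : vertex) : Prop :=
  ~~ B u /\ exists2 c, B c & adj w c u.

(** Disjoint connected sets [B i] are given, each of which cuts its cluster
into at least three parts that meet a finite list [S]. Their number is bounded
by the length of [S] through an injective labelling of the sets by positions in
[S]. The cluster of [B i] is rooted at its first element in [S]. At least two
of the three parts do not contain the root; each of them has a first element in
[S], and the label of [i] is the larger one of two such first elements. *)
Section encounter_count.
Variables (w : config edge) (I : finType) (B : I -> pred vertex).
Variable S : seq vertex.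
Let conn_off i := conn (avoid (B i) w).
Hypothesis B_disj : forall i j v, B i v -> B j v -> i = j.
Hypothesis B_conn : forall i u v, B i u -> B i v ->
  conn (avoid (predC (B i)) w) u v.
Hypothesis B_tri : forall i, exists u1 u2 u3,
  [/\ [/\ branch w (B i) u1, branch w (B i) u2 & branch w (B i) u3],
      [/\ exists2 s, s \in S & conn_off i u1 s,
          exists2 s, s \in S & conn_off i u2 s &
          exists2 s, s \in S & conn_off i u3 s] &
      [/\ ~ conn_off i u1 u2, ~ conn_off i u1 u3 & ~ conn_off i u2 u3]].

Let first (P : vertex -> Prop) : nat := find (fun s => `[< P s >]) S.
Let pt (n : nat) : vertex := nth (0, 0) S n.

Let firstP P : (exists2 s, s \in S & P s) -> (first P < size S)%N /\ P (pt
  (first P)).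
Proof.
move=> [s sS Ps].
have hs : has (fun s => `[< P s >]) S by apply/hasP; exists s => //;
  exact/asboolP.
split; first by rewrite /first -has_find.
exact/asboolP/(nth_find (0, 0) hs).
Qed.

Let first_min P n : (n < first P)%N -> ~ P (pt n).
Proof. by move=> /(before_find (0, 0)) /negbT /asboolPn. Qed.

Let touch i s : Prop := exists2 c, B i c & conn w c s.
Let root i : vertex := pt (first (touch i)).

(** Besides the label [k], the first element of the part of [u'], the earlier
element [l] of a second part off the root is what makes labels injective. *)
Let label i (k : nat) : Prop := (k < size S)%N /\ exists u u' l,
  [/\ branch w (B i) u, branch w (B i) u', ~ conn_off i u (root i) &
      ~ conn_off i u' (root i)] /\
  [/\ (l < k)%N, k = first (conn_off i u'), conn_off i u' (pt k) &
      conn_off i u (pt l)].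

Let off_sub i u v : conn_off i u v -> conn w u v.
Proof. by apply: conn_mono => e; exact: avoid_sub. Qed.

Let label_of_two_branches i u u' : branch w (B i) u -> branch w (B i) u' ->
    (exists2 s, s \in S & conn_off i u s) -> (exists2 s, s \in S & conn_off i
      u' s) ->
    ~ conn_off i u u' -> ~ conn_off i u (root i) -> ~ conn_off i u' (root i) ->
  exists k, label i k.
Proof.
move=> bu bu' /firstP[ks us] /firstP[ks' us'] nuu' ur ur'.
have [kk|kk|kk] := ltngtP (first (conn_off i u)) (first (conn_off i u')).
- exists (first (conn_off i u')); split => //.
  by exists u, u', (first (conn_off i u)).
- exists (first (conn_off i u)); split => //.
  by exists u', u, (first (conn_off i u')).
- case: nuu'; apply: conn_trans us _; rewrite kk; exact: conn_sym.
Qed.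

Let label_exists i : exists k, label i k.
Proof.
have [u1 [u2 [u3 [[b1 b2 b3] [s1 s2 s3] [n12 n13 n23]]]]] := B_tri i.
have [r1|r1] := pselect (conn_off i u1 (root i)).
  have r2 : ~ conn_off i u2 (root i).
    by move=> r2; apply: n12; apply: conn_trans r1 (conn_sym r2).
  have r3 : ~ conn_off i u3 (root i).
    by move=> r3; apply: n13; apply: conn_trans r1 (conn_sym r3).
  exact: label_of_two_branches b2 b3 s2 s3 n23 r2 r3.
have [r2|r2] := pselect (conn_off i u2 (root i)).
  have r3 : ~ conn_off i u3 (root i).
    by move=> r3; apply: n23; apply: conn_trans r2 (conn_sym r3).
  exact: label_of_two_branches b1 b3 s1 s3 n13 r1 r3.
exact: label_of_two_branches b1 b2 s1 s2 n12 r1 r2.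
Qed.

Let reach y i j : Prop := exists2 c, B j c & conn_off i y c.

Let blob_conn i u v : B i u -> B i v -> conn w u v.
Proof. by move=> /B_conn H /H; apply: conn_mono => e; exact: avoid_sub. Qed.

Let blob_conn_off i j u v : i <> j -> B j u -> B j v -> conn_off i u v.
Proof.
move=> ij /B_conn H /H; apply: conn_mono => e /and3P[we h1 h2].
rewrite /= !negbK in h1 h2; apply/and3P; split => //.
  by apply/negP => hi; apply: ij; exact: B_disj hi h1.
by apply/negP => hi; apply: ij; exact: B_disj hi h2.
Qed.

Let branch_touch i u s : branch w (B i) u -> conn w u s -> touch i s.
Proof. by move=> [_ [c Bc cu]] us; exists c => //; apply: conn_trans us;
  exact: conn_adj. Qed.

(** Sets with the same label are in the same cluster, so that their roots
agree. *)
Let same_root i j s : touch i s -> touch j s -> root i = root j.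
Proof.
move=> [c ci cs] [c' cj c's]; congr pt; congr find; apply/funext => z.
apply/asbool_equiv_eq; split=> -[b bB bz].
  exists c' => //; apply: conn_trans c's _; apply: conn_trans (conn_sym cs) _.
  by apply: conn_trans bz; exact: blob_conn ci bB.
exists c => //; apply: conn_trans cs _; apply: conn_trans (conn_sym c's) _.
by apply: conn_trans bz; exact: blob_conn cj bB.
Qed.

(** On a walk from [y] to [B j], the first visit to the union of [B i] and [B
j] settles which of the two sets is reached without using the other one. *)
Let reach_or i j y c : i <> j -> B j c -> conn w y c ->
  reach y i j \/ reach y j i.
Proof.
move=> ij cj yc; pose F := predU (B i) (B j).
have [Fy|Fy] := boolP (F y).
  case/orP: Fy => yB; [right|left]; exists y => //; exact: conn_refl.
have Fc : F c by rewrite /F /= cj orbT.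
have [c' [d [yc' Fc' c'd Fd]]] := first_hit yc Fc Fy.
have {}yc' k : k = i \/ k = j -> conn_off k y c'.
  move=> kij; apply: conn_mono yc' => e /and3P[we]; rewrite /F /= !negb_or.
  by move=> /andP[h1 h2] /andP[h3 h4]; apply/and3P; case: kij => ->.
move: Fc'; rewrite /F /= negb_or => /andP[ic' jc'].
case/orP: Fd => dB; [right|left]; exists d => //.
  apply: conn_trans (yc' j _) _; [by right|apply: conn_adj].
  rewrite adj_avoid c'd jc'; apply/negP => dj; apply: ij; exact: B_disj dB dj.
apply: conn_trans (yc' i _) _; [by left|apply: conn_adj].
rewrite adj_avoid c'd ic'; apply/negP => di; apply: ij; exact: B_disj di dB.
Qed.

(** If [y] is joined to [B i] off [B j], then [B i] is in the part of [y] with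
respect to [B j]. The other parts at [B j] do not meet [B i], so together with
[B j] they lie in a single part with respect to [B i]. *)
Let branch_off i j y u s : i <> j -> branch w (B j) u -> ~ conn_off j u y ->
  reach y j i -> conn_off j u s -> exists2 c, B j c & conn_off i c s.
Proof.
move=> ij [ju [c cB cu]] uy [d di yd] us.
have ni z : conn_off j u z -> ~~ B i z.
  move=> uz; apply/negP => zi; apply: uy; apply: conn_trans uz _.
  by apply: conn_sym; apply: conn_trans yd _;
    exact: blob_conn_off (nesym ij) di zi.
exists c => //; apply: (@conn_trans _ u).
  apply: conn_adj; rewrite adj_avoid cu /=; apply/andP; split.
    by apply/negP => ci; apply: ij; exact: B_disj ci cB.
  by apply: ni; exact: conn_refl.
have := conn_avoid ni us; apply: conn_mono => e /and3P[we h1 h2].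
by apply/and3P; split => //; exact: avoid_sub we.
Qed.

Let label_conn i j k : label i k -> label j k ->
  root i = root j /\ exists2 c, B j c & conn w (root i) c.
Proof.
move=> [kS [u [u' [l [[_ bu' _ _] [_ _ uk _]]]]]].
move=> [_ [v [v' [m [[_ bv' _ _] [_ _ vk _]]]]]].
have ti : touch i (pt k) by exact: branch_touch bu' (off_sub uk).
have tj : touch j (pt k) by exact: branch_touch bv' (off_sub vk).
have [_ [d di dr]] : (first (touch i) < size S)%N /\ touch i (root i).
  by apply: firstP; exists (pt k) => //; exact: mem_nth.
split; first exact: same_root ti tj.
have [[c' ci ck'] [c cj ck]] := (ti, tj); exists c => //.
apply: conn_trans (conn_sym dr) _; apply: conn_trans (blob_conn di ci) _.
by apply: conn_trans ck' _; exact: conn_sym.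
Qed.

(** If [B j] were cut off from the root by [B i], both elements of [S] that
define the label of [j] would be in the same part with respect to [B i]; as the
label is not the first element of this part, it could not be the label of [i].
*)
Let label_off i j k : i <> j -> label i k -> label j k ->
  reach (root i) i j.
Proof.
move=> ij li lj; apply: contrapT => nr; have [rE [c cj rc]] := label_conn li lj.
have {rc cj c} [//|rj] := reach_or ij cj rc.
case: li => _ [u [u' [l [_ [_ kE uk _]]]]].
case: lj => _ [v [v' [m [[bv bv' vr vr'] [mk _ vk vm]]]]].
rewrite -rE in vr vr'.
have [c1 c1j c1m] := branch_off ij bv vr rj vm.
have [c2 c2j c2k] := branch_off ij bv' vr' rj vk.
move: mk; rewrite kE => /first_min; apply.
apply: conn_trans uk _; apply: conn_trans (conn_sym c2k) _.
by apply: conn_trans c1m; exact: blob_conn_off ij c2j c1j.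
Qed.

(** When neither set cuts the other one off from the root, the parts off the
root at [B i] and at [B j] are disjoint. *)
Let label_inj i j k : label i k -> label j k -> i = j.
Proof.
move=> li lj; apply: contrapT => ij.
have ri := label_off ij li lj; have [rE _] := label_conn li lj.
have [d di rd] := label_off (nesym ij) lj li.
case: li => _ [u [u' [l [[_ bu' _ ur'] [_ _ uk _]]]]].
case: lj => _ [v [v' [m [[_ _ _ vr'] [_ _ vk _]]]]].
have [c ci ck] := branch_off (nesym ij) bu' ur' ri uk.
apply: vr'; apply: conn_trans vk _; apply: conn_trans (conn_sym ck) _.
by apply: conn_trans (conn_sym rd); exact: blob_conn_off (nesym ij) ci di.
Qed.

Lemma card_encounters : (#|I| <= size S)%N.
Proof.
have /choice[h hP] := label_exists.
have hS i : (h i < size S)%N by case: (hP i).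
pose f i := Ordinal (hS i).
rewrite -[X in (_ <= X)%N]card_ord; apply: (@leq_card _ _ f) => i j [hE].
by apply: (label_inj (hP i)); rewrite hE.
Qed.

End encounter_count.

(** * Opening edges under finite energy *)

(** The lower bound holds almost everywhere only; [f] is replaced by its
maximum with [c] to have a nonnegative integrand. *)
Lemma le_integral_lower_bound d (T : measurableType d) (R : realType)
    (P : probability T R) (B : set T) (f : T -> R) (c : R) :
    measurable B -> 0 <= c -> measurable_fun setT f ->
    {ae P, forall w, (c%:E <= (EFin \o f) w)%E} ->
  (c%:E * P B <= \int[P]_(w in B) (f w)%:E)%E.
Proof.
move=> mB c0 mf cf.
pose g w := Num.max (f w) c.
have mg : measurable_fun setT g by exact: measurable_maxr.
have -> : (\int[P]_(w in B) (f w)%:E = \int[P]_(w in B) (g w)%:E)%E.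
  apply: ae_eq_integral => //.
  - by apply: measurable_funTS; exact/measurable_EFinP.
  - by apply: measurable_funTS; exact/measurable_EFinP.
  - apply: filterS cf => w /=; rewrite lee_fin => cfw _.
    by rewrite /g (max_idPl cfw).
have <- : (\int[P]_(w in B) cst c%:E w = c%:E * P B)%E by exact: integral_cst.
apply: ge0_le_integral => //.
- by apply: measurable_funTS; exact/measurable_EFinP.
- by move=> w _; rewrite lee_fin /g le_max lexx orbT.
Qed.

(** [A] does not depend on the state of [e]. This is easier to check than
membership in the sigma-algebra of the other edges, which it implies. *)
Definition off_edge (e : edge) (A : set (config edge)) : Prop :=
  forall w w' : config edge,
    (forall e', e' != e -> w e' = w' e') -> A w -> A w'.

Definition fill (e : edge) (w : config {e' : edge | e' != e}) : config edge :=
  fun e' => if insub e' is Some x then w x else false.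

Lemma measurable_fill e : measurable_fun setT (@fill e).
Proof.
apply: measurable_config => e'; rewrite /fill.
case: insubP => [x _ _|_]; first by exists x, id.
have ne : (e.1, ~~ e.2) != e by case: e => v [] /=; apply/eqP => -[].
by exists (Sub (e.1, ~~ e.2) ne), (fun=> false).
Qed.

Lemma off_edge_preimage e A : measurable A -> off_edge e A ->
  g_sigma_algebra_preimage (@away e) A.
Proof.
move=> mA offA; exists (@fill e @^-1` A).
  exact: measurable_pre (@measurable_fill e) mA.
rewrite setTI; apply/seteqP; split => w /=; apply: offA => e' ne;
  by rewrite /fill /away insubT.
Qed.

(** The conditional probability that [e] is open is bounded below by a positive
constant on events that do not depend on [e]. *)
Lemma insertion_null (R : realType) (mu : probability (config edge) R)
    (e : edge) (A : set (config edge)) :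
    finite_energy mu -> measurable A -> off_edge e A ->
  mu (A `&` [set w | w e]) = 0%E -> mu A = 0%E.
Proof.
move=> [delta delta0 fe] mA offA Ae; have [f [mf fint fE] [fdelta _]] := fe e.
have mf' : measurable_fun [set: config edge] f.
  by apply/measurable_EFinP; case/integrableP: fint.
have := le_integral_lower_bound mA (ltW delta0) mf' (elimT ess_infP fdelta).
rewrite fE; last exact: off_edge_preimage.
rewrite setIC Ae => H; apply/eqP; rewrite eq_le measure_ge0 andbT.
by move: H; rewrite pmule_rle0.
Qed.

Lemma measurable_all_open (s : seq edge) :
  measurable [set w : config edge | all (fun e => w e) s].
Proof.
elim: s => [|e s IH] /=; first exact: measurable_const.
rewrite (_ : [set w | _] = [set w : config edge | w e] `&`
    [set w : config edge | all (fun e => w e) s]); last first.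
  by apply/seteqP; split => w /andP.
by apply: measurableI => //; exact: measurable_open.
Qed.

Lemma insertion_null_seq (R : realType) (mu : probability (config edge) R)
    (s : seq edge) (A : set (config edge)) :
    finite_energy mu -> measurable A -> (forall e, e \in s -> off_edge e A) ->
    mu (A `&` [set w | all (fun e => w e) s]) = 0%E -> mu A = 0%E.
Proof.
move=> fe; elim: s A => [|e s IH] A mA offA.
  by move=> A0; rewrite -[A]setIT -A0; congr (mu (_ `&` _)); apply/seteqP;
    split.
have [es|es] := boolP (e \in s).
  move=> A0; apply: IH => //; first by move=> e' e's; apply: offA;
    rewrite inE e's orbT.
  rewrite -A0; congr (mu (_ `&` _)); apply/seteqP; split => w /=;
    last by case/andP.
  by move=> ws; rewrite ws andbT; exact: (allP ws).
move=> A0.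
apply: IH => //; first by move=> e' e's; apply: offA; rewrite inE e's orbT.
apply: (insertion_null (e := e)) => //.
  by apply: measurableI => //; exact: measurable_all_open.
  move=> w w' ww' [Aw ws]; split; first by apply: offA ww' Aw; rewrite mem_head.
  apply/allP => e' e's; rewrite -ww'; first exact: (allP ws).
  by apply: contraNneq es => <-.
rewrite -A0 -setIA; congr (mu (_ `&` _)).
by apply/seteqP; split => w /=; [move=> [-> ->]|case/andP].
Qed.

(** * Boxes meeting three infinite clusters *)

Definition box (n : nat) : pred vertex := fun v => (nrm v <= n)%N.

Definition interior (n : nat) : seq edge :=
  [seq e <- allpairs pair (box_seq n) [:: true; false] |
     box n (tail e) && box n (Defs.head e)].

Lemma mem_interior n e :
  (e \in interior n) = box n (tail e) && box n (Defs.head e).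
Proof.
rewrite mem_filter andb_idr // => /andP[te _]; case: e te => v s vn.
by apply: allpairs_f; [exact: mem_box_seq|case: (s)].
Qed.

(** Only edges with an endpoint outside of the box are involved, so that this
event does not depend on the inner edges. *)
Definition crowded (n : nat) (w : config edge) : Prop :=
  exists u1 u2 u3 : vertex,
  [/\ [/\ branch w (box n) u1, branch w (box n) u2 & branch w (box n) u3],
      [/\ infcl (avoid (box n) w) u1, infcl (avoid (box n) w) u2 &
          infcl (avoid (box n) w) u3] &
      [/\ ~ conn (avoid (box n) w) u1 u2, ~ conn (avoid (box n) w) u1 u3 &
          ~ conn (avoid (box n) w) u2 u3]].

Lemma measurable_branch (B : pred vertex) u : measurable [set w | branch w B u].
Proof.
have -> : [set w | branch w B u] =
    [set w | ~~ B u /\ exists c, B c /\ adj w c u].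
  apply/seteqP; split => w [Bu]; first by move=> [c Bc cu]; split => //;
    exists c.
  by move=> [c [Bc cu]]; split => //; exists c.
apply: measurable_ifb; apply: measurable_exists => c.
by apply: measurable_ifb; exact: measurable_adj.
Qed.

Lemma measurable_crowded n : measurable [set w | crowded n w].
Proof.
have mb u := measurable_branch (box n) u.
have mi u := measurable_pre (measurable_avoid (box n)) (measurable_infcl u).
have mc u v := measurableC
  (measurable_pre (measurable_avoid (box n)) (measurable_conn u v)).
apply: measurable_exists => u1; apply: measurable_exists => u2.
apply: measurable_exists => u3.
have := measurableI _ _ (measurableI _ _ (measurableI _ _ (mb u1) (mb u2)) (mb
  u3))
  (measurableI _ _ (measurableI _ _ (measurableI _ _ (mi u1) (mi u2)) (mi u3))
  (measurableI _ _ (measurableI _ _ (mc u1 u2) (mc u1 u3)) (mc u2 u3))).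
congr measurable; apply/seteqP; split => w /=.
  by move=> [[[b1 b2] b3] [[[i1 i2] i3] [[c1 c2] c3]]].
by move=> [[b1 b2 b3] [i1 i2 i3] [c1 c2 c3]].
Qed.

Lemma crowded_of_three n w b1 b2 b3 : box n b1 -> box n b2 -> box n b3 ->
    infcl w b1 -> infcl w b2 -> infcl w b3 ->
    ~ conn w b1 b2 -> ~ conn w b1 b3 -> ~ conn w b2 b3 -> crowded n w.
Proof.
move=> B1 B2 B3 i1 i2 i3 n12 n13 n23.
have exit b : box n b -> infcl w b -> exists u,
    [/\ branch w (box n) u, infcl (avoid (box n) w) u & conn w b u].
  move=> Bb binf; have [|f [u [bf Bf fu Bu uinf]]] := infcl_avoid Bb binf.
    apply: (@sub_finite_set _ _ [set` box_seq n]); last exact: finite_seq.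
    by move=> f [Bf _]; exact: mem_box_seq.
  exists u; split => //; first by split => //; exists f.
  by apply: conn_trans bf _; exact: conn_adj.
have [u1 [r1 I1 c1]] := exit _ B1 i1.
have [u2 [r2 I2 c2]] := exit _ B2 i2.
have [u3 [r3 I3 c3]] := exit _ B3 i3.
have no b b' u u' : ~ conn w b b' -> conn w b u -> conn w b' u' ->
    ~ conn (avoid (box n) w) u u'.
  move=> nb bu bu' uu'; apply: nb; apply: conn_trans bu _.
  apply: (conn_trans _ (conn_sym bu')); apply: conn_mono uu' => e.
  exact: avoid_sub.
exists u1, u2, u3; split; split => //.
- exact: no n12 c1 c2.
- exact: no n13 c1 c3.
- exact: no n23 c2 c3.
Qed.

Lemma infinite_set_pick T (A F : set T) :
  infinite_set A -> finite_set F -> exists2 x, A x & ~ F x.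
Proof.
move=> Ainf Ffin; apply: contrapT => H; apply: Ainf; apply: sub_finite_set Ffin.
by move=> x Ax; apply: contrapT => Fx; apply: H; exists x.
Qed.

Lemma finite_of_not_crowded w :
  (forall n, ~ crowded n w) -> finite_set (infinite_clusters setT (open_edges
    w)).
Proof.
move=> nc; apply: contrapT => inf.
have [C1 A1 _] := infinite_set_pick inf (finite_set0 _).
have [C2 A2 n12] := infinite_set_pick inf (finite_set1 C1).
have fin12 : finite_set ([set C1] `|` [set C2]) by rewrite finite_setU.
have [C3 A3 n3] := infinite_set_pick inf fin12.
case: A1 n12 n3 => -[v1 _ <-] i1; case: A2 => -[v2 _ <-] i2.
case: A3 => -[v3 _ <-] i3 n12 n3.
have eqC u v : conn w u v ->
    cluster_of (open_edges w) v = cluster_of (open_edges w) u.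
  move=> uv; rewrite !cluster_ofE; apply/seteqP; split => z /=.
    exact: conn_trans.
  by apply: conn_trans; exact: conn_sym.
pose n := maxn (nrm v1) (maxn (nrm v2) (nrm v3)).
apply: (nc n); apply: (@crowded_of_three n w v1 v2 v3) => //.
- by rewrite /box leq_maxl.
- by rewrite /box /n maxnCA leq_maxl.
- by rewrite /box /n (maxnC (nrm v2)) maxnCA leq_maxl.
- by move=> c12; apply: n12; exact: eqC.
- by move=> c13; apply: n3; left; exact: eqC.
- by move=> c23; apply: n3; right; exact: eqC.
Qed.

Definition encounter (n : nat) (w : config edge) : Prop :=
  crowded n w /\ all (fun e => w e) (interior n).

(** Neither the complement of the box nor the edges that leave the box contain
the inner edge [e]. *)
Lemma crowded_off_edge n e : e \in interior n ->
  off_edge e [set w | crowded n w].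
Proof.
rewrite mem_interior => /andP[te he] w w' ww'.
have avE : avoid (box n) w = avoid (box n) w'.
  apply/funext => e'; rewrite /avoid; have [->|ne] := eqVneq e' e.
    by rewrite te !andbF.
  by rewrite ww'.
have brE u : branch w (box n) u -> branch w' (box n) u.
  move=> [Bu [c Bc /existsP[s cu]]]; split => //; exists c => //.
  apply/existsP; exists s; case/orP: cu => /andP[/eqP uE ws]; apply/orP.
    left; rewrite uE eqxx -ww' //; apply: contra Bu => /eqP ee.
    by rewrite uE; move: he; rewrite -ee.
  right; rewrite -uE eqxx -ww' //; apply: contra Bu => /eqP ee.
  by move: te; rewrite -ee.
rewrite /= /crowded avE => -[u1 [u2 [u3 [[b1 b2 b3] I C]]]].
by exists u1, u2, u3; split => //; split; exact: brE.
Qed.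

(** Every vertex of the box is joined to the centre, by steps towards the
coordinate axes. *)
Lemma box_connected n w u v : all (fun e => w e) (interior n) ->
  box n u -> box n v -> conn (avoid (predC (box n)) w) u v.
Proof.
move=> /allP open.
have step e : box n (tail e) -> box n (Defs.head e) ->
    conn (avoid (predC (box n)) w) (tail e) (Defs.head e).
  move=> te he; apply: conn_adj; apply/existsP; exists e.2; apply/orP; left.
  rewrite /Defs.head eqxx /= /avoid /= !negbK te he -surjective_pairing.
  by rewrite open // mem_interior te.
suff H m a : (absz a.1 + absz a.2 <= m)%N -> box n a ->
    conn (avoid (predC (box n)) w) a (0, 0).
  by move=> Bu Bv; apply: conn_trans (H _ _ (leqnn _) Bu) (conn_sym (H _ _
    (leqnn _) Bv)).
elim: m a => [|m IH] [x y] /= xym Bxy.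
  have -> : x = 0 by clear -xym; lia.
  have -> : y = 0 by clear -xym; lia.
  exact: conn_refl.
have hd e : Defs.head e = (e.1.1 + (~~ e.2)%:R, e.1.2 + e.2%:R).
  by rewrite /Defs.head generatorE; case: e => [[a b] s].
move: Bxy; rewrite /box /nrm geq_max /= => /andP[xn yn].
have go (e : edge) : box n (tail e) -> box n (Defs.head e) ->
    ((x, y) = tail e /\ (absz (Defs.head e).1 + absz (Defs.head e).2 <= m)%N) \/
    ((x, y) = Defs.head e /\ (absz (tail e).1 + absz (tail e).2 <= m)%N) ->
    conn (avoid (predC (box n)) w) (x, y) (0, 0).
  move=> te he [[-> em]|[-> em]].
    by apply: conn_trans (step e te he) _; exact: IH.
  by apply: conn_trans (conn_sym (step e te he)) _; exact: IH.
have [x0|x0|x0] := ltgtP x 0.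
- apply: (go ((x, y), false)); rewrite ?hd /box /nrm /tail /= ?geq_max;
    [|..|left; split => //]; clear -xn yn x0 xym; lia.
- apply: (go ((x - 1, y), false)); rewrite ?hd /box /nrm /tail /= ?geq_max;
    [| |right; split; [congr pair|]]; clear -xn yn x0 xym; lia.
- have [y0|y0|y0] := ltgtP y 0.
  + apply: (go ((x, y), true)); rewrite ?hd /box /nrm /tail /= ?geq_max;
    [|..|left; split => //]; clear -xn yn y0 xym; lia.
  + apply: (go ((x, y - 1), true)); rewrite ?hd /box /nrm /tail /= ?geq_max;
    [| |right; split; [congr pair|]]; clear -xn yn y0 xym; lia.
  + rewrite x0 y0; exact: conn_refl.
Qed.

(** * The density of encounter boxes *)

Definition sphere (N : nat) : seq vertex :=
  let r := sym_interval N in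
  [seq (Posz N, y) | y <- r] ++ [seq (- Posz N, y) | y <- r] ++
  [seq (x, Posz N) | x <- r] ++ [seq (x, - Posz N) | x <- r].

Lemma size_sphere N : size (sphere N) = (4 * (N + N).+1)%N.
Proof. by rewrite !size_cat !size_map size_iota; lia. Qed.

Lemma mem_sphere N v : nrm v = N -> v \in sphere N.
Proof.
case: v => a b; rewrite /nrm => vN.
have mx : `|a|%N = N /\ (`|b| <= N)%N \/ `|b|%N = N /\ (`|a| <= N)%N.
  by move: vN => /=; lia.
rewrite !mem_cat; apply/or4P; case: mx => -[aN /mem_sym_interval bN].
  have [a0|a0] := leP 0 a.
    constructor 1; apply/mapP; exists b => //; congr pair; clear -aN a0; lia.
  constructor 2; apply/mapP; exists b => //; congr pair; clear -aN a0; lia.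
have [b0|b0] := leP 0 b.
  constructor 3; apply/mapP; exists a => //; congr pair; clear -aN b0; lia.
constructor 4; apply/mapP; exists a => //; congr pair; clear -aN b0; lia.
Qed.

Lemma adj_nrm w u v : adj w u v -> (nrm v <= (nrm u).+1)%N.
Proof.
case/existsP => s; rewrite generatorE.
case: u v => [a b] [c d]; case: s => /orP[]/andP[/eqP[-> ->] _];
  rewrite /nrm /=; lia.
Qed.

Lemma infcl_sphere w u N : (nrm u < N)%N -> infcl w u ->
  exists2 s, s \in sphere N & conn w u s.
Proof.
move=> uN /(@far_vertex _ N)[v /cluster_ofP uv vN].
have [||c' [c [uc' Nc' cc Nc]]] := @first_hit (fun z => (N <= nrm z)%N) _ _ _
  uv.
- exact: ltnW.
- by rewrite -ltnNge.
exists c; last first.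
  by apply: conn_trans (conn_adj cc); apply: conn_mono uc' => e;
    exact: avoid_sub.
apply: mem_sphere; apply/eqP; rewrite eqn_leq Nc andbT.
by apply: leq_trans (adj_nrm cc) _; rewrite ltnNge.
Qed.

(** The spacing 2 n + 1 makes the boxes of radius [n] around the points of the
grid disjoint. *)
Definition grid (n M : nat) (i : 'I_M * 'I_M) : vertex :=
  (Posz ((n + n).+1 * i.1), Posz ((n + n).+1 * i.2)).

Lemma grid_disjoint n M (i j : 'I_M * 'I_M) z :
  box n (z - grid n i) -> box n (z - grid n j) -> i = j.
Proof.
case: i j z => [i1 i2] [j1 j2] [x y]; rewrite /box /nrm /grid /= !geq_max.
move=> /andP[h1 h2] /andP[h3 h4].
have sep (a b : nat) (x' : int) : (`|(x' - Posz ((n + n).+1 * a))%R| <= n)%N ->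
    (`|(x' - Posz ((n + n).+1 * b))%R| <= n)%N -> a = b.
  clear; move=> ha hb; nia.
by congr pair; apply: val_inj => /=; [exact: sep h1 h3|exact: sep h2 h4].
Qed.

Lemma branch_translate n w v u : branch (translate (- v) w) (box n) u ->
  branch w (fun z => box n (z - v)) (u + v).
Proof.
move=> [Bu [c Bc cu]]; split; first by rewrite addrK.
by exists (c + v); rewrite ?addrK //; move: cu; rewrite adj_translate !opprK.
Qed.

(** The vertices next to a box of the grid still belong to the ball of radius
(2 n + 1) M, hence are inside of the sphere in [encounter_count]. *)
Lemma grid_nrm n M (i : 'I_M * 'I_M) (z : vertex) :
  (nrm (z - grid n i)%R <= n.+1)%N -> (nrm z <= (n + n).+1 * M)%N.
Proof.
case: i z => [[i hi] [j hj]] [x y]; rewrite /nrm /grid /= !geq_max.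
by move=> /andP[h1 h2]; apply/andP; split; nia.
Qed.

(** Infinite parts that start inside of a sphere around the grid cross it, so
[card_encounters] applies with the sphere as the list [S]; its size grows
linearly in [M], while the grid has [M ^ 2] points. *)
Lemma encounter_count n M w :
  (\sum_(i : 'I_M * 'I_M) `[< encounter n (translate (- grid n i) w) >]
    <= 4 * (2 * ((n + n).+1 * M).+1).+1)%N.
Proof.
pose P (i : 'I_M * 'I_M) := `[< encounter n (translate (- grid n i) w) >].
pose I := {i : 'I_M * 'I_M | P i}.
pose S := sphere ((n + n).+1 * M).+1.
have SE : size S = (4 * (2 * ((n + n).+1 * M).+1).+1)%N.
  by rewrite size_sphere mul2n addnn.
have -> : (\sum_(i : 'I_M * 'I_M) `[< encounter n (translate (- grid n i) w) >]
    = #|{: I}|)%N.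
  by rewrite card_sig -sum1_card [RHS]big_mkcond; apply: eq_bigr => i _;
    rewrite inE /P; case: ifP.
rewrite -SE; apply: (@card_encounters w I (fun i z => box n (z - grid n (val
  i)))).
- by move=> i j z zi zj; apply: val_inj; exact: grid_disjoint zi zj.
- move=> [i /= /asboolP[_ open]] u v ui vi.
  have := box_connected open ui vi.
  by rewrite avoid_translate => /conn_translate; rewrite !opprK !subrK.
- move=> [i /= /asboolP[[u1 [u2 [u3 [[b1 b2 b3] [i1 i2 i3] [c1 c2 c3]]]]] _]].
  set g := grid n i in b1 b2 b3 i1 i2 i3 c1 c2 c3 *.
  have avE : avoid (box n) (translate (- g) w) =
      translate (- g) (avoid (fun z => box n (z - g)) w).
    by rewrite avoid_translate.
  have inf u : branch (translate (- g) w) (box n) u ->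
      infcl (avoid (box n) (translate (- g) w)) u ->
      exists2 s, s \in S & conn (avoid (fun z => box n (z - g)) w) (u + g) s.
    move=> [_ [c Bc cu]]; rewrite avE => /infcl_translate;
      rewrite opprK => uinf.
    apply: infcl_sphere uinf; rewrite ltnS; apply: (@grid_nrm _ _ i).
    by rewrite -/g addrK; apply: leq_trans (adj_nrm cu) _.
  have nc u v : ~ conn (avoid (box n) (translate (- g) w)) u v ->
      ~ conn (avoid (fun z => box n (z - g)) w) (u + g) (v + g).
    by rewrite avE => uv uv'; apply: uv; apply/conn_translate; rewrite !opprK.
  exists (u1 + g), (u2 + g), (u3 + g); split; split.
  + exact: branch_translate.
  + exact: branch_translate.
  + exact: branch_translate.
  + exact: inf.
  + exact: inf.
  + exact: inf.
  + exact: nc.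
  + exact: nc.
  + exact: nc.
Qed.

Lemma measure_encounter (R : realType) (mu : probability (config edge) R) n :
  translation_invariant mu -> mu [set w | encounter n w] = 0%E.
Proof.
move=> inv.
have mE : measurable [set w | encounter n w].
  exact: measurableI _ _ (measurable_crowded n) (measurable_all_open _).
have fin : mu [set w | encounter n w] \is a fin_num by exact: fin_num_measure.
rewrite -(fineK fin); congr EFin.
(* [c * M] bounds the size of the sphere for all positive [M]. *)
pose c : nat := (4 * (2 * (n + n).+1 + 3))%N.
apply: (@archi_null _ _ c%:R); first by rewrite fine_ge0.
case=> [|M]; first by rewrite mul0r.
set x := fine _.
have := mean_count inv mE (fun w => @encounter_count n M.+1 w).
rewrite card_prod !card_ord -(fineK fin) -EFinM lee_fin -/x => H.
have M0 : 0 < M.+1%:R :> R by rewrite ltr0n.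
rewrite -(ler_pM2l M0) mulrA -natrM -natrM; apply: le_trans H _.
by rewrite ler_nat /c; nia.
Qed.

(** If a box meets three infinite clusters then it is crowded, and crowded
boxes are almost surely absent because opening their inner edges would create
encounter boxes. *)
Lemma finite_energy_fin (R : realType) (mu : probability (config edge) R) :
    translation_invariant mu -> finite_energy mu ->
  {ae mu, forall w, finite_set (infinite_clusters setT (open_edges w))}.
Proof.
move=> inv fe.
have H : {ae mu, forall w, forall n, ~ crowded n w}.
  apply: ae_forall => n; apply: (ae_null (measurable_crowded n)).
  apply: (insertion_null_seq fe (measurable_crowded n) (@crowded_off_edge n)).
  exact: measure_encounter.
by apply: filterS H => w; exact: finite_of_not_crowded.
Qed.

Theorem corollary1p3 (R : realType) (mu : probability (config edge) R) :
  self_dual mu -> translation_invariant mu -> ergodic mu ->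
  ({ae mu, forall w, finite_set (infinite_clusters setT (open_edges w))} ->
   {ae hp_marginal mu, forall w,
      infinite_clusters [set` upper] (hp_open_edges w) = set0}) /\
  (finite_energy mu ->
   {ae hp_marginal mu, forall w,
      infinite_clusters [set` upper] (hp_open_edges w) = set0}).
Proof.
move=> sd inv erg.
have main : {ae mu, forall w, finite_set (infinite_clusters setT (open_edges
  w))} ->
    {ae hp_marginal mu, forall w,
       infinite_clusters [set` upper] (hp_open_edges w) = set0}.
  by move=> fin; apply: hp_marginal_no_cluster; exact: ae_hp_inf0.
by split => // fe; apply: main; exact: finite_energy_fin.
Qed.
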